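(* For every positive integer $n\ge 2$ with $n\neq 3$, the CQG algebras $A_u(n)$ and $B_u(n)$ are residually finite-dimensional (RFD).
   Context: All algebras are unital and over $\mathbb{C}$. A $*$-algebra is an algebra with a conjugate-linear, multiplication-reversing involution $*$; $M_m(\mathbb{C})$ carries the conjugate-transpose involution. RFD: a $*$-algebra $A$ is residually finite-dimensional (RFD) if for every $0\ne a\in A$ there is a $*$-representation $\pi$ of $A$ on a finite-dimensional Hilbert space (a $*$-homomorphism $\pi:A\to M_m(\mathbb{C})$ for some $m\geq 1$) with $\pi(a)\ne 0$. $A_u(n)$ is the $*$-algebra freely generated by $n^2$ elements $u_{ij}$, $1\le i,j\le n$, subject to the relations saying that both matrices $(u_{ij})_{i,j}$ and $(u_{ji})_{i,j}$ are unitary elements of the $*$-algebra $M_n(A_u(n))$. $B_u(n)$ is the $*$-algebra freely generated by $n^2$ elements $v_{ij}$, $1\le i,j\le n$, subject to the analogous relations (both $(v_{ij})_{i,j}$ and $(v_{ji})_{i,j}$ are unitary in $M_n(B_u(n))$) and in addition $v_{ij}^*=v_{ij}$ for all $i,j$. Both are Hopf $*$-algebras (in fact CQG algebras) with $\Delta(u_{ij})=\sum_k u_{ik}\otimes u_{kj}$, $\varepsilon(u_{ij})=\delta_{ij}$, and similarly for the $v_{ij}$. *)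

(* Defs.v *)
From HB Require Import structures.
From mathcomp Require Import all_boot all_order all_algebra.
From mathcomp Require Import ring_quotient.
From mathcomp Require Import boolp classical_sets.
From mathcomp Require Import reals complex.
From mathcomp Require Import finmap monalg.

Set Implicit Arguments.
Unset Strict Implicit.
Unset Printing Implicit Defensive.

Import Order.TTheory GRing.Theory Num.Theory.
Local Open Scope fset_scope.
Local Open Scope ring_scope.

HB.mixin Record Algebra_hasStar (C : numClosedFieldType) A
    of GRing.Algebra C A := {
  star : A -> A;
  starD : {morph star : x y / x + y};
  starZ : forall (c : C) (x : A), star (c *: x) = c^* *: star x;
  starM : forall x y : A, star (x * y) = star y * star x;
  starK : involutive star
}.

#[short(type="starAlgType")]
HB.structure Definition StarAlgebra (C : numClosedFieldType) :=
  {A of GRing.Algebra C A & Algebra_hasStar C A}.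

Section StarTheory.
Variables (C : numClosedFieldType) (A : starAlgType C).

Fact star_is_zmod_morphism : zmod_morphism (@star C A).
Proof. by move=> x y; rewrite starD -scaleN1r starZ rmorphN1 scaleN1r. Qed.

HB.instance Definition _ := GRing.isZmodMorphism.Build A A (@star C A)
  star_is_zmod_morphism.

Lemma star1 : star (1 : A) = 1.
Proof. by rewrite -[LHS]mul1r -{1}(starK 1) -starM mul1r starK. Qed.

(* The involution of M_n(A). *)
Definition mxstar m n (M : 'M[A]_(m, n)) : 'M[A]_(n, m) :=
  map_mx (@star C A) M^T.

Definition mx_unitary n (M : 'M[A]_n) : Prop :=
  M *m mxstar M = 1%:M /\ mxstar M *m M = 1%:M.

End StarTheory.

(* The conjugate-transpose involution of M_m(C), m >= 1. *)
Section MatrixStar.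
Variables (C : numClosedFieldType) (m : nat).
Implicit Types M N : 'M[C]_m.+1.

Definition conjmx_tr M : 'M[C]_m.+1 := map_mx (@Num.conj C) M^T.

Fact conjmx_trD : {morph conjmx_tr : M N / M + N}.
Proof. by move=> M N; rewrite /conjmx_tr linearD map_mxD. Qed.

Fact conjmx_trZ (c : C) M : conjmx_tr (c *: M) = c^* *: conjmx_tr M.
Proof. by rewrite /conjmx_tr linearZ map_mxZ. Qed.

Fact conjmx_trM M N : conjmx_tr (M * N) = conjmx_tr N * conjmx_tr M.
Proof. by rewrite /conjmx_tr trmx_mul map_mxM. Qed.

Fact conjmx_trK : involutive conjmx_tr.
Proof. by move=> M; apply/matrixP=> i j; rewrite !mxE conjCK. Qed.

HB.instance Definition _ := Algebra_hasStar.Build C 'M[C]_m.+1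
  conjmx_trD conjmx_trZ conjmx_trM conjmx_trK.

End MatrixStar.

Definition RFD (C : numClosedFieldType) (A : starAlgType C) : Prop :=
  forall a : A, a != 0 ->
  exists (m : nat) (pi : {lrmorphism A -> 'M[C]_m.+1}),
    {morph pi : x / star x} /\ pi a != 0.

(* The free *-algebra on X: the free algebra on the letters x and x^*, the   *)
(* letter (false, x) standing for x and (true, x) for x^*.                   *)
Section FreeStar.
Variables (C : numClosedFieldType) (X : choiceType).

Definition free_star : Type := {malg C[{fmonom (bool * X)%type}]}.

HB.instance Definition _ := GRing.Lalgebra.on free_star.

Implicit Types (g : free_star) (w : {fmonom (bool * X)%type}).

Fact free_scalerAr (c : C) (g1 g2 : free_star) :
  c *: (g1 * g2) = g1 * (c *: g2).
Proof.
apply/malgP=> k; rewrite [LHS]mcoeffZ.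
rewrite [X in c * X](mcoeffMl g1 g2 k).
have le2 : msupp (c *: g2) `<=` msupp g2 by exact: msuppZ_le.
rewrite (mcoeffMlw k (fsubset_refl _) le2) mulr_sumr.
apply: eq_bigr => k1 _; rewrite mulr_sumr; apply: eq_bigr => k2 _.
by rewrite mcoeffZ mulrCA mulrnAr.
Qed.

HB.instance Definition _ := GRing.Lalgebra_isAlgebra.Build C free_star
  free_scalerAr.

Definition free_gen (x : X) : free_star := << fmu (false, x) >>.

Definition word_star w : {fmonom (bool * X)%type} :=
  FMonom (rev [seq (~~ p.1, p.2) | p <- fmonom_val w]).

Definition free_star_op g : free_star :=
  \sum_(w <- msupp g) << (g@_w)^* *g word_star w >>.

Fact word_starK : involutive word_star.
Proof.
move=> [s]; congr FMonom; rewrite /= map_rev revK -map_comp.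
by rewrite -[RHS]map_id; apply: eq_map => -[b x] /=; rewrite negbK.
Qed.

Fact word_starM w1 w2 :
  word_star (mmul w1 w2) = mmul (word_star w2) (word_star w1).
Proof.
by apply/eqP; rewrite fmP fmM /= fmM map_cat rev_cat.
Qed.

Fact mcoeff_free_star_op g w : (free_star_op g)@_w = (g@_(word_star w))^*.
Proof.
rewrite raddf_sum /=.
have E w' : (<< (g@_w')^* *g word_star w' >> : free_star)@_w =
            if w' == word_star w then (g@_w')^* else 0.
  rewrite mcoeffU mulrb; congr (if _ then _ else _).
  by rewrite (can2_eq word_starK word_starK).
rewrite (eq_bigr _ (fun w' _ => E w')) -big_mkcond /=.
have [wg|wg] := boolP (word_star w \in msupp g).
  by rewrite -big_filter filter_pred1_uniq ?fset_uniq // big_seq1.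
rewrite (mcoeff_outdom wg) conjC0 big1_seq // => w' /andP[/eqP -> w'g].
by rewrite w'g in wg.
Qed.

Fact free_starD : {morph free_star_op : g1 g2 / g1 + g2}.
Proof.
move=> g1 g2; apply/malgP=> k; rewrite mcoeff_free_star_op mcoeffD rmorphD.
by rewrite [RHS]mcoeffD; congr (_ + _); rewrite mcoeff_free_star_op.
Qed.

Fact free_starZ (c : C) g : free_star_op (c *: g) = c^* *: free_star_op g.
Proof.
apply/malgP=> k; rewrite mcoeff_free_star_op.
by rewrite [RHS]mcoeffZ mcoeffZ rmorphM; congr (_ * _); rewrite mcoeff_free_star_op.
Qed.

Fact free_starK : involutive free_star_op.
Proof. by move=> g; apply/malgP=> k; rewrite !mcoeff_free_star_op word_starK conjCK. Qed.

Fact free_starU (c : C) w :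
  free_star_op << c *g w >> = << c^* *g word_star w >>.
Proof.
apply/malgP=> k; rewrite mcoeff_free_star_op !mcoeffU.
rewrite (can2_eq word_starK word_starK).
by case: eqP => _; rewrite ?mulr1n ?mulr0n ?conjC0.
Qed.

Fact free_star_sum (I : Type) (r : seq I) (F : I -> free_star) :
  free_star_op (\sum_(i <- r) F i) = \sum_(i <- r) free_star_op (F i).
Proof.
apply: (big_morph _ free_starD); apply/malgP=> k.
by rewrite mcoeff_free_star_op !mcoeff0 conjC0.
Qed.

Fact free_starM g1 g2 :
  free_star_op (g1 * g2) = free_star_op g2 * free_star_op g1.
Proof.
rewrite malgME free_star_sum [RHS]mulr_sumr; apply: eq_bigr => w1 _.
rewrite free_star_sum [RHS]mulr_suml; apply: eq_bigr => w2 _.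
by rewrite free_starU word_starM [RHS]fgmulUU rmorphM mulrC.
Qed.

HB.instance Definition _ := Algebra_hasStar.Build C free_star
  free_starD free_starZ free_starM free_starK.

(* The universal property of free_star, for maps into B. *)
Section Lift.
Variables (B : starAlgType C) (f : X -> B).

Definition letter_lift (p : (bool * X)%type) : B :=
  if p.1 then star (f p.2) else f p.2.

Definition word_lift w : B := \prod_(p <- fmonom_val w) letter_lift p.

Fact word_lift_mmorphism : mmorphism word_lift.
Proof.
split=> [w1 w2|]; last by rewrite /word_lift fm1 big_nil.
by rewrite /word_lift fmM big_cat.
Qed.

HB.instance Definition _ := isMultiplicative.Build _ _ word_lift
  word_lift_mmorphism.

Definition free_lift : free_star -> B := mmap (in_alg B) word_lift.

Fact free_lift_is_zmod_morphism : zmod_morphism free_lift.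
Proof. exact: mmap_is_additive. Qed.

Fact free_lift_is_monoid_morphism : monoid_morphism free_lift.
Proof.
have [] := @commr_mmap_is_multiplicative _ _ _ (in_alg B) word_lift.
  by move=> g m m'; rewrite /GRing.comm /= mulr_algl mulr_algr.
by [].
Qed.

Fact free_lift_is_scalable : scalable free_lift.
Proof. by move=> c g; rewrite /free_lift mmapZ mulr_algl. Qed.

HB.instance Definition _ := GRing.isZmodMorphism.Build free_star B free_lift
  free_lift_is_zmod_morphism.
HB.instance Definition _ := GRing.isMonoidMorphism.Build free_star B free_lift
  free_lift_is_monoid_morphism.
HB.instance Definition _ := GRing.isScalable.Build C free_star B _ free_lift
  free_lift_is_scalable.

Lemma free_lift_gen x : free_lift (free_gen x) = f x.
Proof. by rewrite /free_lift mmapU /= scale1r mul1r /word_lift fmU big_seq1. Qed.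

Fact word_lift_star w : word_lift (word_star w) = star (word_lift w).
Proof.
case: w => s; rewrite /word_lift /=; elim: s => [|[b x] s IHs].
  by rewrite !big_nil star1.
rewrite big_cons starM -IHs /= rev_cons -cats1 big_cat big_seq1 /=.
by congr (_ * _); case: b; rewrite /letter_lift //= starK.
Qed.

Lemma free_lift_star : {morph free_lift : g / star g}.
Proof.
move=> g; rewrite {1}/star /= /free_star_op raddf_sum [in RHS]/free_lift mmapE.
rewrite raddf_sum; apply: eq_bigr => w _ /=.
rewrite /free_lift mmapU word_lift_star /= !mulr_algl starZ.
by [].
Qed.

End Lift.

End FreeStar.

Arguments free_gen {C X} x.

Section StarIdeal.
Local Open Scope quotient_scope.
Variables (C : numClosedFieldType) (A : starAlgType C) (S : set A).

(* The smallest two-sided *-ideal containing S. *)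
Inductive star_ideal : A -> Prop :=
| star_ideal_gen x of S x : star_ideal x
| star_ideal0 : star_ideal 0
| star_idealD x y of star_ideal x & star_ideal y : star_ideal (x + y)
| star_idealMl a x of star_ideal x : star_ideal (a * x)
| star_idealMr a x of star_ideal x : star_ideal (x * a)
| star_idealS x of star_ideal x : star_ideal (star x).

Definition star_idealb : {pred A} := fun x => `[< star_ideal x >].

Fact star_idealP x : reflect (star_ideal x) (x \in star_idealb).
Proof. exact: asboolP. Qed.

Fact star_idealN x : star_ideal x -> star_ideal (- x).
Proof. by move=> Ix; rewrite -mulN1r; apply: star_idealMl. Qed.

Fact star_ideal_zmod_closed : zmod_closed star_idealb.
Proof.
split=> [|x y /star_idealP Ix /star_idealP Iy]; apply/star_idealP.
  exact: star_ideal0.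
by apply: star_idealD => //; apply: star_idealN.
Qed.

HB.instance Definition _ := GRing.isZmodClosed.Build A star_idealb
  star_ideal_zmod_closed.

(* MathComp algebras are nonzero, hence the properness argument. *)
Definition star_quot of ~ star_ideal 1 : Type := Quotient.quot star_idealb.

Variable proper : ~ star_ideal 1.
Local Notation Q := (star_quot proper).

HB.instance Definition _ := GRing.Zmodule.on Q.
HB.instance Definition _ : EqQuotient A (Quotient.equiv star_idealb) Q :=
  EqQuotient.on Q.

Implicit Types x y : A.

Fact star_quotP x y : reflect (star_ideal (x - y)) (\pi_Q x == \pi_Q y).
Proof. by rewrite piE Quotient.equivE; apply: star_idealP. Qed.

Fact star_quotK x : star_ideal (repr (\pi_Q x) - x).
Proof. by apply/star_quotP; rewrite reprK. Qed.

Fact star_quot_piD : {morph \pi_Q : x y / x + y}.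
Proof. exact: (@pi_addr _ _ _ _ _ (Quotient.quot star_idealb)). Qed.

Definition star_quot_mul (a b : Q) : Q := \pi_Q (repr a * repr b).
Definition star_quot_scale (c : C) (a : Q) : Q := \pi_Q (c *: repr a).
Definition star_quot_star (a : Q) : Q := \pi_Q (star (repr a)).

Fact star_quot_piM : {morph \pi_Q : x y / x * y >-> star_quot_mul x y}.
Proof.
move=> x y; apply/esym/eqP/star_quotP.
set x' := repr _; set y' := repr _.
have -> : x' * y' - x * y = (x' - x) * y' + x * (y' - y).
  by rewrite mulrBl mulrBr addrA subrK.
apply: star_idealD; first exact: star_idealMr (star_quotK _).
exact: star_idealMl (star_quotK _).
Qed.

Fact star_quot_piZ c x : \pi_Q (c *: x) = star_quot_scale c (\pi_Q x).
Proof.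
apply/esym/eqP/star_quotP.
rewrite -scalerBr -mulr_algl; exact: star_idealMl (star_quotK _).
Qed.

Fact star_quot_piS x : \pi_Q (star x) = star_quot_star (\pi_Q x).
Proof.
apply/esym/eqP/star_quotP.
rewrite -raddfB; exact: star_idealS (star_quotK _).
Qed.

Let pi_elim (P : Q -> Prop) : (forall x, P (\pi_Q x)) -> forall a, P a.
Proof. by move=> h a; rewrite -[a]reprK. Qed.

Fact star_quot_mulA : associative star_quot_mul.
Proof.
elim/pi_elim=> x; elim/pi_elim=> y; elim/pi_elim=> z.
by rewrite -!star_quot_piM mulrA.
Qed.

Fact star_quot_mul1l : left_id (\pi_Q 1) star_quot_mul.
Proof. by elim/pi_elim=> x; rewrite -star_quot_piM mul1r. Qed.

Fact star_quot_mul1r : right_id (\pi_Q 1) star_quot_mul.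
Proof. by elim/pi_elim=> x; rewrite -star_quot_piM mulr1. Qed.

Fact star_quot_mulDl : left_distributive star_quot_mul +%R.
Proof.
elim/pi_elim=> x; elim/pi_elim=> y; elim/pi_elim=> z.
by rewrite -star_quot_piD -!star_quot_piM mulrDl star_quot_piD.
Qed.

Fact star_quot_mulDr : right_distributive star_quot_mul +%R.
Proof.
elim/pi_elim=> x; elim/pi_elim=> y; elim/pi_elim=> z.
by rewrite -star_quot_piD -!star_quot_piM mulrDr star_quot_piD.
Qed.

Fact star_quot1_neq0 : \pi_Q 1 != 0 :> Q.
Proof.
have -> : 0 = \pi_Q 0 by rewrite (@pi_zeror _ _ _ _ _ (Quotient.quot star_idealb)).
by apply/star_quotP; rewrite subr0.
Qed.

HB.instance Definition _ := GRing.Zmodule_isNzRing.Build Q star_quot_mulA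
  star_quot_mul1l star_quot_mul1r star_quot_mulDl star_quot_mulDr
  star_quot1_neq0.

Fact star_quot_scaleA c d a :
  star_quot_scale c (star_quot_scale d a) = star_quot_scale (c * d) a.
Proof. by elim/pi_elim: a => x; rewrite -!star_quot_piZ scalerA. Qed.

Fact star_quot_scale1 : left_id 1 star_quot_scale.
Proof. by elim/pi_elim=> x; rewrite -star_quot_piZ scale1r. Qed.

Fact star_quot_scaleDr : right_distributive star_quot_scale +%R.
Proof.
move=> c; elim/pi_elim=> x; elim/pi_elim=> y.
by rewrite -star_quot_piD -!star_quot_piZ scalerDr star_quot_piD.
Qed.

Fact star_quot_scaleDl a : {morph star_quot_scale^~ a : c d / c + d}.
Proof.
move=> c d; elim/pi_elim: a => x.
by rewrite -!star_quot_piZ scalerDl star_quot_piD.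
Qed.

HB.instance Definition _ := GRing.Zmodule_isLmodule.Build C Q
  star_quot_scaleA star_quot_scale1 star_quot_scaleDr star_quot_scaleDl.

Fact star_quot_scaleAl (c : C) (a b : Q) : c *: (a * b) = (c *: a) * b.
Proof.
elim/pi_elim: a => x; elim/pi_elim: b => y.
rewrite /GRing.scale /GRing.mul /=.
by rewrite -star_quot_piM -!star_quot_piZ -star_quot_piM scalerAl.
Qed.

HB.instance Definition _ := GRing.Lmodule_isLalgebra.Build C Q
  star_quot_scaleAl.

Fact star_quot_scaleAr (c : C) (a b : Q) : c *: (a * b) = a * (c *: b).
Proof.
elim/pi_elim: a => x; elim/pi_elim: b => y.
rewrite /GRing.scale /GRing.mul /=.
by rewrite -star_quot_piM -!star_quot_piZ -star_quot_piM scalerAr.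
Qed.

HB.instance Definition _ := GRing.Lalgebra_isAlgebra.Build C Q
  star_quot_scaleAr.

Fact star_quot_starD : {morph star_quot_star : a b / a + b}.
Proof.
elim/pi_elim=> x; elim/pi_elim=> y.
by rewrite -star_quot_piD -!star_quot_piS starD star_quot_piD.
Qed.

Fact star_quot_starZ (c : C) (a : Q) :
  star_quot_star (c *: a) = c^* *: star_quot_star a.
Proof.
elim/pi_elim: a => x; rewrite /GRing.scale /=.
by rewrite -star_quot_piZ -!star_quot_piS starZ star_quot_piZ.
Qed.

Fact star_quot_starM (a b : Q) :
  star_quot_star (a * b) = star_quot_star b * star_quot_star a.
Proof.
elim/pi_elim: a => x; elim/pi_elim: b => y; rewrite /GRing.mul /=.
by rewrite -star_quot_piM -!star_quot_piS starM star_quot_piM.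
Qed.

Fact star_quot_starK : involutive star_quot_star.
Proof. by elim/pi_elim=> x; rewrite -!star_quot_piS starK. Qed.

HB.instance Definition _ := Algebra_hasStar.Build C Q
  star_quot_starD star_quot_starZ star_quot_starM star_quot_starK.

Definition star_quot_pi (x : A) : Q := \pi_Q x.

Fact star_quot_pi_is_zmod_morphism : zmod_morphism star_quot_pi.
Proof.
move=> x y; apply: (addIr (star_quot_pi y)).
by rewrite subrK -star_quot_piD subrK.
Qed.

Fact star_quot_pi_is_monoid_morphism : monoid_morphism star_quot_pi.
Proof. by split=> // x y; rewrite /star_quot_pi star_quot_piM. Qed.

Fact star_quot_pi_is_scalable : scalable star_quot_pi.
Proof. by move=> c x; rewrite /star_quot_pi star_quot_piZ. Qed.

HB.instance Definition _ := GRing.isZmodMorphism.Build A Q star_quot_pi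
  star_quot_pi_is_zmod_morphism.
HB.instance Definition _ := GRing.isMonoidMorphism.Build A Q star_quot_pi
  star_quot_pi_is_monoid_morphism.
HB.instance Definition _ := GRing.isScalable.Build C A Q _ star_quot_pi
  star_quot_pi_is_scalable.

Lemma star_quot_pi_star : {morph star_quot_pi : x / star x}.
Proof. exact: star_quot_piS. Qed.

Lemma star_quot_pi_eq0 x : star_quot_pi x = 0 <-> star_ideal x.
Proof.
rewrite -(raddf0 star_quot_pi) -{2}(subr0 x).
by split=> [/eqP/star_quotP|/star_quotP/eqP].
Qed.

Lemma star_quot_piP (a : Q) : exists x, star_quot_pi x = a.
Proof. by exists (repr a); apply: reprK. Qed.

End StarIdeal.

Lemma star_ideal_ker (C : numClosedFieldType) (A B : starAlgType C) (S : set A)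
    (f : {lrmorphism A -> B}) :
  {morph f : x / star x} -> (forall x, S x -> f x = 0) ->
  forall x, star_ideal S x -> f x = 0.
Proof.
move=> fS f0 x; elim=> {x}.
- exact: f0.
- exact: raddf0.
- by move=> x y _ fx _ fy; rewrite rmorphD /= fx fy addr0.
- by move=> a x _ fx; rewrite rmorphM /= fx mulr0.
- by move=> a x _ fx; rewrite rmorphM /= fx mul0r.
- by move=> x _ fx; rewrite fS fx raddf0.
Qed.

Section QuotientLift.
Variables (C : numClosedFieldType) (A B : starAlgType C) (S : set A).
Variables (proper : ~ star_ideal S 1) (f : {lrmorphism A -> B}).
Hypotheses (fS : {morph f : x / star x}) (f0 : forall x, S x -> f x = 0).

Lemma star_quot_lift : exists g : {lrmorphism star_quot proper -> B},
  {morph g : a / star a} /\ forall x, g (star_quot_pi proper x) = f x.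
Proof.
pose g (a : star_quot proper) : B := f (repr a).
have gE x : g (star_quot_pi proper x) = f x.
  apply/eqP; rewrite -subr_eq0 -raddfB; apply/eqP.
  exact: (star_ideal_ker fS f0 (star_quotK proper x)).
have g_zmod : zmod_morphism g.
  move=> a b; have [x <-] := star_quot_piP a; have [y <-] := star_quot_piP b.
  by rewrite -raddfB !gE raddfB.
have g_mon : monoid_morphism g.
  split=> [|a b]; first by rewrite -(rmorph1 (star_quot_pi proper)) gE rmorph1.
  have [x <-] := star_quot_piP a; have [y <-] := star_quot_piP b.
  by rewrite -rmorphM !gE rmorphM.
have g_scal : scalable g.
  by move=> c a; have [x <-] := star_quot_piP a; rewrite -linearZ !gE linearZ.
pose gA := GRing.isZmodMorphism.Build _ _ g g_zmod.
pose gM := GRing.isMonoidMorphism.Build _ _ g g_mon.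
pose gZ := GRing.isScalable.Build C _ _ _ g g_scal.
pose g' : {lrmorphism star_quot proper -> B} := HB.pack g gA gM gZ.
exists g'; split=> [a|x]; last exact: gE.
have [x <-] := star_quot_piP a.
by rewrite -star_quot_pi_star /= !gE fS.
Qed.

End QuotientLift.

Section UniversalQuantumGroups.
Local Open Scope classical_set_scope.
Variables (C : numClosedFieldType) (n : nat).

Local Notation F := (free_star C ('I_n * 'I_n)%type).

Definition free_mx : 'M[F]_n := \matrix_(i, j) free_gen (i, j).

(* x = 0, for x in unitary_rel M, says that M is unitary. *)
Definition unitary_rel (M : 'M[F]_n) : set F :=
  [set x | exists i j, x = (M *m mxstar M - 1%:M) i j \/
                       x = (mxstar M *m M - 1%:M) i j].

Definition selfadj_rel (M : 'M[F]_n) : set F :=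
  [set x | exists i j, x = star (M i j) - M i j].

Definition A_u_rel : set F := unitary_rel free_mx `|` unitary_rel free_mx^T.

Definition B_u_rel : set F := A_u_rel `|` selfadj_rel free_mx.

(* The counit, at which all the relations hold. *)
Local Notation counit :=
  (free_lift (fun p : 'I_n * 'I_n => (p.1 == p.2)%:R : 'M[C]_1)).

Fact star_natb (b : bool) : star (b%:R : 'M[C]_1) = b%:R.
Proof. by case: b; rewrite ?star1 ?raddf0. Qed.

Fact counit_free_mx : map_mx counit free_mx = 1%:M.
Proof. by apply/matrixP=> i j; rewrite !mxE free_lift_gen. Qed.

Fact counit_mxstar (M : 'M[F]_n) :
  map_mx counit (mxstar M) = mxstar (map_mx counit M).
Proof. by apply/matrixP=> i j; rewrite !mxE free_lift_star. Qed.

Fact mxstar1 : mxstar (1%:M : 'M['M[C]_1]_n) = 1%:M.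
Proof. by apply/matrixP=> i j; rewrite !mxE star_natb eq_sym. Qed.

Fact counit_unitary (M : 'M[F]_n) x :
  map_mx counit M = 1%:M -> unitary_rel M x -> counit x = 0.
Proof.
move=> M1 Mx.
have M2 : map_mx counit (M *m mxstar M - 1%:M) = 0.
  by rewrite map_mxB map_mxM counit_mxstar M1 mxstar1 mulmx1 map_mx1 subrr.
have M3 : map_mx counit (mxstar M *m M - 1%:M) = 0.
  by rewrite map_mxB map_mxM counit_mxstar M1 mxstar1 mulmx1 map_mx1 subrr.
case: Mx => i [j [->|->]].
- by move/matrixP: M2 => /(_ i j); rewrite [LHS]mxE [RHS]mxE.
- by move/matrixP: M3 => /(_ i j); rewrite [LHS]mxE [RHS]mxE.
Qed.

Fact counit_B_u_rel x : B_u_rel x -> counit x = 0.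
Proof.
case=> [[|]|[i [j ->]]].
- exact: counit_unitary counit_free_mx.
- by apply: counit_unitary; rewrite -map_trmx counit_free_mx trmx1.
- by rewrite mxE raddfB /= free_lift_star free_lift_gen star_natb subrr.
Qed.

Fact B_u_proper : ~ star_ideal B_u_rel 1.
Proof.
move=> I1; have /eqP : counit 1 = 0.
  exact: (star_ideal_ker (@free_lift_star _ _ _ _) counit_B_u_rel).
by rewrite rmorph1 oner_eq0.
Qed.

Fact A_u_proper : ~ star_ideal A_u_rel 1.
Proof.
move=> I1; have /eqP : counit 1 = 0.
  apply: (star_ideal_ker (@free_lift_star _ _ _ _) _ I1) => x Sx.
  by apply: counit_B_u_rel; left.
by rewrite rmorph1 oner_eq0.
Qed.

Definition A_u : starAlgType C := star_quot A_u_proper.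
Definition B_u : starAlgType C := star_quot B_u_proper.

Definition A_u_mx : 'M[A_u]_n := map_mx (star_quot_pi A_u_proper) free_mx.
Definition B_u_mx : 'M[B_u]_n := map_mx (star_quot_pi B_u_proper) free_mx.

Lemma unitary_relP (B : starAlgType C) (f : {lrmorphism F -> B})
    (M : 'M[F]_n) : {morph f : x / star x} ->
  (forall x, unitary_rel M x -> f x = 0) <-> mx_unitary (map_mx f M).
Proof.
move=> fS.
have fM : map_mx f (mxstar M) = mxstar (map_mx f M).
  by apply/matrixP=> i j; rewrite !mxE fS.
have E1 : map_mx f (M *m mxstar M - 1%:M) =
    map_mx f M *m mxstar (map_mx f M) - 1%:M.
  by rewrite map_mxB map_mxM fM map_mx1.
have E2 : map_mx f (mxstar M *m M - 1%:M) =
    mxstar (map_mx f M) *m map_mx f M - 1%:M.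
  by rewrite map_mxB map_mxM fM map_mx1.
split=> [f0|[M1 M2] x].
  split; apply: subr0_eq; [rewrite -E1|rewrite -E2]; apply/matrixP=> i j;
    rewrite [LHS]mxE [RHS]mxE; apply: f0; exists i, j; [exact: or_introl|].
  exact: or_intror.
rewrite M1 subrr in E1; rewrite M2 subrr in E2.
case=> i [j [->|->]].
- by move/matrixP: E1 => /(_ i j); rewrite [LHS]mxE [RHS]mxE.
- by move/matrixP: E2 => /(_ i j); rewrite [LHS]mxE [RHS]mxE.
Qed.

Lemma A_u_mx_unitary : mx_unitary A_u_mx /\ mx_unitary A_u_mx^T.
Proof.
have piS := @star_quot_pi_star _ _ _ A_u_proper.
split; [|rewrite map_trmx]; apply/(unitary_relP _ piS) => x Sx;
  apply/star_quot_pi_eq0/star_ideal_gen.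
- by left.
- by right.
Qed.

Lemma B_u_mx_unitary : mx_unitary B_u_mx /\ mx_unitary B_u_mx^T.
Proof.
have piS := @star_quot_pi_star _ _ _ B_u_proper.
split; [|rewrite map_trmx]; apply/(unitary_relP _ piS) => x Sx;
  apply/star_quot_pi_eq0/star_ideal_gen; left.
- by left.
- by right.
Qed.

Lemma B_u_mx_selfadj i j : star (B_u_mx i j) = B_u_mx i j.
Proof.
apply/eqP; rewrite -subr_eq0 !mxE -star_quot_pi_star -raddfB; apply/eqP.
apply/star_quot_pi_eq0/star_ideal_gen; right; exists i, j.
by rewrite mxE.
Qed.

Lemma A_u_universal (B : starAlgType C) (M : 'M[B]_n) :
  mx_unitary M -> mx_unitary M^T ->
  exists g : {lrmorphism A_u -> B},
    {morph g : a / star a} /\ map_mx g A_u_mx = M.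
Proof.
move=> MU MTU; pose f := free_lift (fun p : 'I_n * 'I_n => M p.1 p.2).
have fM : map_mx f free_mx = M.
  by apply/matrixP=> i j; rewrite !mxE /f free_lift_gen.
have fS := free_lift_star (fun p : 'I_n * 'I_n => M p.1 p.2).
have [x Sx|g [gS gE]] := star_quot_lift A_u_proper fS.
  case: Sx; apply: (unitary_relP _ fS).2; first by rewrite fM.
  by rewrite -map_trmx fM.
exists g; split=> //; rewrite -[RHS]fM.
apply/matrixP=> i j; rewrite [LHS]mxE [RHS]mxE.
by rewrite [A_u_mx i j]mxE; apply: gE.
Qed.

Lemma B_u_universal (B : starAlgType C) (M : 'M[B]_n) :
  mx_unitary M -> mx_unitary M^T -> (forall i j, star (M i j) = M i j) ->
  exists g : {lrmorphism B_u -> B},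
    {morph g : a / star a} /\ map_mx g B_u_mx = M.
Proof.
move=> MU MTU MS; pose f := free_lift (fun p : 'I_n * 'I_n => M p.1 p.2).
have fM : map_mx f free_mx = M.
  by apply/matrixP=> i j; rewrite !mxE /f free_lift_gen.
have fS := free_lift_star (fun p : 'I_n * 'I_n => M p.1 p.2).
have [x Sx|g [gS gE]] := star_quot_lift B_u_proper fS.
  case: Sx => [|[i [j ->]]].
    case; apply: (unitary_relP _ fS).2; first by rewrite fM.
    by rewrite -map_trmx fM.
  by rewrite mxE raddfB /= free_lift_star free_lift_gen MS subrr.
exists g; split=> //; rewrite -[RHS]fM.
apply/matrixP=> i j; rewrite [LHS]mxE [RHS]mxE.
by rewrite [B_u_mx i j]mxE; apply: gE.
Qed.

End UniversalQuantumGroups.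

(* Main.v *)
Require Import Defs.
From mathcomp Require Import all_boot all_order all_algebra.
From mathcomp Require Import reals complex.
From mathcomp Require Import boolp finmap monalg ring zify.

(** Idea. Write u^c for u or its entrywise adjoint, according to a colour c.
  In A_u(n) the relations only rewrite sum_j u^c_ja u^c'_jb and
  sum_j u^c_aj u^c'_bj (c <> c') as scalars, so modulo lower degree the
  coefficients (alpha_IJ) of the words of a given colour pattern and of maximal
  degree k only matter modulo the span of the tensors with a factor
  q = sum_j e_j (x) e_j at a place where the colour changes, in I or in J. In
  B_u(n) there is one colour, and q may occur anywhere.

  A tensor lies in that span as soon as it is orthogonal to all chains
  x_1 (x) ... (x) x_k of real unit vectors such that x_i is orthogonal to
  x_{i+1} wherever the colours allow a contraction. Two chains x, y give a
  finite-dimensional representation: take a path h_0, ..., h_k, let u act along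
  the edge h_{i-1} h_i, oriented by the i-th colour, through the matrix
  x_i y_i^T, add a copy of the path with reversed edges, and join the two copies
  by partial isometries completing everything to a biunitary. Going from h_0 to
  h_k takes k steps, so the (h_0, h_k) entry kills words of degree less than k,
  and sends the word of degree k with rows I and columns J to x_I y_J if it has
  the given colours, to 0 otherwise.

  Hence if all finite-dimensional representations kill an element of degree
  k, then its leading coefficients vanish on chains, so that it has degree less
  than k; by induction it is 0. *)

Set Implicit Arguments.
Unset Strict Implicit.
Unset Printing Implicit Defensive.

Import Order.TTheory GRing.Theory Num.Theory.
Local Open Scope ring_scope.

(** * Forms vanishing on chains of orthogonal vectors *)

Section Chains.
Variables (C : numClosedFieldType) (n : nat) (G : Type) (adj : rel G).
Local Notation vec := ('I_n -> C).

Definition dot (x y : vec) : C := \sum_i x i * y i.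
Definition evec (j : 'I_n) : vec := fun i => (i == j)%:R.

Lemma dot_evec x j : dot x (evec j) = x j.
Proof.
rewrite /dot (bigD1 j) //= /evec eqxx mulr1 big1 ?addr0 // => i /negbTE ->.
by rewrite mulr0.
Qed.

Lemma dotC x y : dot x y = dot y x.
Proof. by apply: eq_bigr => i _; rewrite mulrC. Qed.

Lemma dot_linl a b x y z :
  dot (fun i => a * x i + b * y i) z = a * dot x z + b * dot y z.
Proof.
rewrite /dot !mulr_sumr -big_split; apply: eq_bigr => i _ /=; ring.
Qed.

Lemma dot0l x : dot (fun=> 0) x = 0.
Proof. by rewrite /dot big1 // => i _; rewrite mul0r. Qed.

(* Whether [c] may be contracted with the colour that follows it. *)
Definition capped (c : G) (s : seq G) : bool := if s is c' :: _ then adj c c' else false.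

Section Values.
Variables (T : Type) (W0 : (T -> C) -> Prop).
Hypothesis W00 : W0 (fun=> 0).
Hypothesis W0_lin : forall (a b : C) f g, W0 f -> W0 g ->
  W0 (fun t => a * f t + b * g t).

(* A form gives the coordinates of a tensor on words in [e_1, ..., e_n], with
   values in [T -> C]; it is only relevant on words of the length at hand. *)
Local Notation form := (seq 'I_n -> T -> C).
Implicit Types (s : seq G) (psi phi : form).

(** The tensor product of [x] with [phi]. The value 0 on the empty word means that the last letter
    has nothing to be contracted with. *)
Definition lmul (x : vec) phi : form :=
  fun w t => if w is l :: w' then x l * phi w' t else 0.

Definition slice (x : vec) psi : form := fun w t => \sum_j x j * psi (j :: w) t.

Fixpoint ev (xs : seq vec) psi : T -> C :=
  if xs is x :: xs' then ev xs' (slice x psi) else psi [::].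

(* [psi] is zero modulo [W0] and the tensors containing [\sum_j e_j (x) e_j] at
   two consecutive places whose colours in [s] are related by [adj]; here [phi]
   is what follows the factor [\sum_j e_j (x) e_j] in the first two places. *)
Fixpoint null s psi : Prop :=
  if s is c :: s' then
    exists phi, (capped c s' \/ forall w t, phi w t = 0) /\
      forall j, null s' (fun w t => psi (j :: w) t - lmul (evec j) phi w t)
  else W0 (psi [::]).

Lemma null_ext s psi phi : (forall w t, psi w t = phi w t) -> null s psi -> null s phi.
Proof.
by move=> E; suff -> : psi = phi by []; apply/funext => w; apply/funext => t.
Qed.

Lemma null_nil_ext psi phi : (forall t, psi [::] t = phi [::] t) ->
  null [::] psi -> null [::] phi.
Proof.
by move=> E; rewrite /=; suff -> : psi [::] = phi [::] by []; apply/funext.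
Qed.

Lemma null0 s : null s (fun _ _ => 0).
Proof.
elim: s => //= c s IHs; exists (fun _ _ => 0); split; first by right.
by move=> j; apply: null_ext IHs => -[|l w] t /=; ring.
Qed.

Lemma null_lin s a b psi phi : null s psi -> null s phi ->
  null s (fun w t => a * psi w t + b * phi w t).
Proof.
elim: s psi phi => [|c s IHs] psi phi /=; first exact: W0_lin.
move=> [p [okp Hp]] [q [okq Hq]].
exists (fun w t => a * p w t + b * q w t); split.
  case: okp okq => [|p0] okq; first by left.
  by case: okq => [|q0]; [left | right => w t; rewrite p0 q0; ring].
move=> j; apply: null_ext (IHs _ _ (Hp j) (Hq j)) => -[|l w] t /=; ring.
Qed.

Lemma nullZ s a psi : null s psi -> null s (fun w t => a * psi w t).
Proof.
by move=> H; apply: null_ext (null_lin a 0 H (null0 s)) => w t; ring.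
Qed.

Lemma nullZ_cancel s a psi : a != 0 -> null s (fun w t => a * psi w t) -> null s psi.
Proof.
by move=> a0 H; apply: null_ext (nullZ a^-1 H) => w t; rewrite mulKf.
Qed.

Lemma null_sum (I : Type) (r : seq I) s (F : I -> form) :
  (forall i, null s (F i)) -> null s (fun w t => \sum_(i <- r) F i w t).
Proof.
move=> H; elim: r => [|i r IHr].
  by apply: null_ext (null0 s) => w t; rewrite big_nil.
by apply: null_ext (null_lin 1 1 (H i) IHr) => w t; rewrite big_cons; ring.
Qed.

Lemma slice_lin a b x y psi w t :
  slice (fun i => a * x i + b * y i) psi w t = a * slice x psi w t + b * slice y psi w t.
Proof.
rewrite /slice !mulr_sumr -big_split; apply: eq_bigr => i _ /=; ring.
Qed.

Lemma lmul_lin a b x y phi w t :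
  lmul (fun i => a * x i + b * y i) phi w t = a * lmul x phi w t + b * lmul y phi w t.
Proof. by case: w => [|l w] /=; ring. Qed.

Lemma slice_evec j psi w t : slice (evec j) psi w t = psi (j :: w) t.
Proof.
rewrite /slice (bigD1 j) //= /evec eqxx mul1r big1 ?addr0 // => i /negbTE ->.
by rewrite mul0r.
Qed.

Lemma slice_lmul x y phi w t : slice x (lmul y phi) w t = dot x y * phi w t.
Proof. by rewrite /slice /dot mulr_suml; apply: eq_bigr => i _ /=; ring. Qed.

Lemma slice_formlin x a b psi phi w t :
  slice x (fun w t => a * psi w t + b * phi w t) w t =
  a * slice x psi w t + b * slice x phi w t.
Proof.
rewrite /slice !mulr_sumr -big_split; apply: eq_bigr => i _ /=; ring.
Qed.

Lemma null_slice c s psi : null (c :: s) psi ->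
  exists phi, (capped c s \/ forall w t, phi w t = 0) /\
    forall x, null s (fun w t => slice x psi w t - lmul x phi w t).
Proof.
move=> [phi [ok H]]; exists phi; split=> // x.
have := null_sum (index_enum 'I_n) (fun j => nullZ (x j) (H j)).
apply: null_ext => w t; rewrite /slice.
transitivity (\sum_i (x i * psi (i :: w) t - x i * lmul (evec i) phi w t)).
  by apply: eq_bigr => i _; ring.
rewrite big_split /= sumrN; congr (_ - _).
case: w => [|l w] /=; first by rewrite big1 // => i _; rewrite mulr0.
rewrite (bigD1 l) //= /evec eqxx mul1r big1 ?addr0 // => i /negbTE.
by rewrite eq_sym => ->; rewrite mul0r mulr0.
Qed.

Lemma null_of_slice c s psi phi : (capped c s \/ forall w t, phi w t = 0) ->
  (forall j, null s (fun w t => slice (evec j) psi w t - lmul (evec j) phi w t)) ->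
  null (c :: s) psi.
Proof.
move=> ok H; exists phi; split=> // j.
by apply: null_ext (H j) => w t; rewrite slice_evec.
Qed.

Lemma null_lmul c s x phi : null s phi -> null (c :: s) (lmul x phi).
Proof.
move=> H; apply: (@null_of_slice _ _ _ (fun _ _ => 0)); first by right.
move=> j; apply: null_ext (nullZ (x j) H) => w t; rewrite slice_lmul.
by rewrite dotC dot_evec; case: w => [|l w] /=; ring.
Qed.

Definition realv (x : vec) := forall i, x i \is Num.real.

Lemma realv_lin a b x y : a \is Num.real -> b \is Num.real -> realv x -> realv y ->
  realv (fun i => a * x i + b * y i).
Proof. by move=> ra rb rx ry i; rewrite realD ?realM. Qed.

Lemma realv_evec j : realv (evec j).
Proof. by move=> i; rewrite /evec realn. Qed.

Lemma real_dot x y : realv x -> realv y -> dot x y \is Num.real.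
Proof. by move=> rx ry; apply: sum_real => i _; rewrite realM. Qed.

Lemma dot_ge0 x : realv x -> 0 <= dot x x.
Proof. by move=> rx; apply: sumr_ge0 => i _; rewrite -expr2 real_exprn_even_ge0. Qed.

Lemma dot_eq0 x : realv x -> dot x x = 0 -> forall i, x i = 0.
Proof.
move=> rx /eqP; rewrite psumr_eq0 => [|i _]; last first.
  by rewrite -expr2 real_exprn_even_ge0.
by move=> /allP H i; have := H i (mem_index_enum i); rewrite /= mulf_eq0 orbb => /eqP.
Qed.

Lemma dot_neq0 x : realv x -> dot x x != 0 -> exists i, x i != 0.
Proof.
move=> rx; apply: contraNP => /forallNP x0; apply/eqP; apply: big1 => i _.
by have /negP := x0 i; rewrite negbK => /eqP ->; rewrite mul0r.
Qed.

(** * Cancellation of tensor factors modulo null forms *)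

Hypothesis n_gt1 : (1 < n)%N.

Lemma ex_orth (x : vec) i : x i != 0 ->
  exists y : vec, [/\ realv x -> realv y, exists j, y j != 0 & dot y x = 0].
Proof.
move=> xi.
have [j ji] : exists j, j != i.
  have [/eqP i0|i0] := boolP (i == Ordinal (ltnW n_gt1)).
    by exists (Ordinal n_gt1); rewrite i0.
  by exists (Ordinal (ltnW n_gt1)); rewrite eq_sym.
exists (fun l => x j * evec i l + - x i * evec j l); split.
- by move=> rx; apply: realv_lin; rewrite ?realN; [apply: rx | apply: rx | apply: realv_evec..].
- by exists j; rewrite /evec eqxx (negbTE ji) mulr0 add0r mulr1 oppr_eq0.
by rewrite dot_linl ![dot (evec _) _]dotC !dot_evec; ring.
Qed.

(** Cancelling [z] by [inj] makes [a] itself null, and any other factor may then be put in front of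
    it. *)
Lemma null_lmul_ker c s z i a : capped c s \/ (forall w t, a w t = 0) ->
    (forall c' s', s = c' :: s' -> null s (lmul z a) -> null s' a) ->
    z i != 0 -> null s (lmul z a) ->
  forall u, null s (lmul u a).
Proof.
case: s => [|c' s] ok inj zi Hz u; last first.
  case: ok => [_|a0]; first by apply: null_lmul; apply: inj Hz.
  by apply: null_ext (null0 _) => -[|l w] t //=; rewrite a0 mulr0.
exact: W00.
Qed.

(** Slicing by a vector orthogonal to [x] kills [lmul x phi] and isolates the contraction term [a],
    which is cancelled by induction; the slice at [i] then gives [x i] times [phi]. *)
Lemma lmul_inj c s x i phi : x i != 0 -> null (c :: s) (lmul x phi) -> null s phi.
Proof.
elim: s c x i phi => [|c' s IHs] c x i phi xi /null_slice [a [ok H]];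
  have [y [_ [j yj] yx]] := ex_orth xi.
- case: ok => // a0; apply: (nullZ_cancel xi).
  apply: null_ext (H (evec i)) => w t; rewrite slice_lmul dotC dot_evec.
  by case: w => [|l w] /=; rewrite ?a0; ring.
- have Hy : null (c' :: s) (lmul y a).
    apply: null_ext (nullZ (-1) (H y)) => w t.
    by rewrite slice_lmul yx; ring.
  have K : forall u, null (c' :: s) (lmul u a).
    apply: (null_lmul_ker ok _ yj Hy) => c1 s1 [_ <-]; exact: IHs yj.
  apply: (nullZ_cancel xi).
  apply: null_ext (null_lin 1 1 (H (evec i)) (K (evec i))) => w t.
  by rewrite slice_lmul dotC dot_evec; ring.
Qed.

(** Slicing by [z] kills both summands, which disposes of the contraction term as in [lmul_inj];
    slicing by [x] then separates [p] from [q]. *)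
Lemma lmul_orth_inj c s x y z i p q :
    z i != 0 -> dot z x = 0 -> dot z y = 0 -> dot x y = 0 -> dot x x != 0 ->
    null (c :: s) (fun w t => lmul x p w t + lmul y q w t) ->
  null s p.
Proof.
move=> zi zx zy xy xx /null_slice [a [ok H]].
have E u w t : slice u (fun w t => lmul x p w t + lmul y q w t) w t =
    dot u x * p w t + dot u y * q w t.
  rewrite -!slice_lmul -[in RHS](mul1r (slice u (lmul x p) w t)).
  rewrite -[in RHS](mul1r (slice u (lmul y q) w t)) -slice_formlin.
  by apply: eq_bigr => j _; rewrite !mul1r.
have Hz : null s (lmul z a).
  apply: null_ext (nullZ (-1) (H z)) => w t.
  by rewrite E zx zy; ring.
have K : forall u, null s (lmul u a).
  apply: (null_lmul_ker ok _ zi Hz) => c1 s1 -> ; exact: lmul_inj zi.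
apply: (nullZ_cancel xx).
apply: null_ext (null_lin 1 1 (H x) (K x)) => w t.
by rewrite E xy; ring.
Qed.

(** * Detection of null forms by chains *)

(** The default 0 is orthogonal to every vector, so the empty chain satisfies any orthogonality
    condition on its head. *)
Definition hdv (xs : seq vec) : vec := head (fun=> 0) xs.

Fixpoint chain s (xs : seq vec) : Prop :=
  match s, xs with
  | [::], [::] => True
  | c :: s', x :: xs' =>
    [/\ realv x, dot x x = 1, capped c s' -> dot x (hdv xs') = 0 & chain s' xs']
  | _, _ => False
  end.


Lemma slice_lmul3 x k1 k2 k3 u1 u2 u3 p1 p2 p3 w t :
  slice x (fun w t =>
    k1 * lmul u1 p1 w t + k2 * lmul u2 p2 w t + k3 * lmul u3 p3 w t) w t =
  k1 * dot x u1 * p1 w t + k2 * dot x u2 * p2 w t + k3 * dot x u3 * p3 w t.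
Proof.
by rewrite /slice /dot !(mulr_suml, mulr_sumr) -!big_split /=;
   apply: eq_bigr => i _; ring.
Qed.

Definition dir (a b : 'I_n) (m : nat) : vec := fun i => 1 * evec a i + m%:R * evec b i.

(* Two values of [m] would do if [2 < n]. In dimension 2 each step of the
   induction excludes some more directions, hence the bound [N]. *)
Lemma null_dir s N (a b : 'I_n) beta : a != b ->
    (forall m, (N <= m)%N ->
      exists phi, null s (fun w t => beta w t - lmul (dir a b m) phi w t)) ->
  null s beta.
Proof.
move=> ab; have [k] := ubnP (size s); elim: k s N beta => // k IHk [|c s] N beta.
  move=> _ H; have [phi Hphi] := H N (leqnn _).
  by apply: null_nil_ext Hphi => t /=; rewrite subr0.
move=> sk H.
have da m : dir a b m a = 1.
  by rewrite /dir /evec eqxx (negbTE ab) mulr0 mulr1 addr0.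
have db m : dir a b m b = m%:R.
  by rewrite /dir /evec eqxx eq_sym (negbTE ab) mulr0 add0r mulr1.
(* This vector is orthogonal to [dir a b m], so slicing by it eliminates [phi]; so does slicing at
   any [j] other than [a] and [b]. *)
pose opp_dir m : vec := fun i => m%:R * evec a i + -1 * evec b i.
have dd m m' : dot (dir a b m) (opp_dir m') = m'%:R - m%:R.
  rewrite dotC dot_linl ![dot (evec _) _]dotC !dot_evec da db; ring.
have {}H m : (N <= m)%N -> exists al,
    [/\ capped c s \/ (forall w t, al w t = 0),
      forall j, j != a -> j != b ->
        null s (fun w t => beta (j :: w) t - lmul (evec j) al w t) &
      null s (fun w t => m%:R * beta (a :: w) t - beta (b :: w) t
                         - lmul (opp_dir m) al w t)].
  move=> Nm; have [phi [al [ok Hal]]] := H m Nm; exists al; split=> //.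
    move=> j ja jb; apply: null_ext (Hal j) => w t /=.
    by rewrite /dir /evec (negbTE ja) (negbTE jb) !mulr0; ring.
  apply: null_ext (null_lin m%:R (-1) (Hal a) (Hal b)) => w t /=.
  rewrite da db /opp_dir; case: w => [|l w] /=; ring.
have [al [ok Hj HN]] := H N (leqnn _).
have [al1 [ok1 _ HN1]] := H N.+1 (leqnSn _).
(* The contraction terms found for [N] and [N.+1] agree modulo null forms, hence [al] can serve for
   [beta]. *)
have K u : null s (lmul u (fun w t => al w t - al1 w t)).
  have [cs|cs] := boolP (capped c s); last first.
    case: ok ok1 => [h|al0] [h1|al10]; try by rewrite ?h ?h1 in cs.
    by apply: null_ext (null0 _) => -[|l w] t //=; rewrite al0 al10; ring.
  have [c' [s' Es]] : exists c' s', s = c' :: s' by case: (s) cs => // c' s'; exists c', s'.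
  subst s; apply: null_lmul; apply: (IHk _ N.+2); first by move: sk => /= /ltnW.
  move=> m Nm; have [am [_ _ Hm]] := H m (ltnW (ltnW Nm)).
  (* Since [opp_dir m] is [(1 - r) * opp_dir N + r * opp_dir N.+1], the matching combination of the
     three relations cancels [beta]. Slicing it by [dir a b m] also kills [am], and leaves
     [- r * (1 - r)] times [al - al1] up to a tensor with first factor [dir a b m], as the induction
     hypothesis requires. The bound [N.+2] keeps [r] and [1 - r] nonzero. *)
  pose r : C := m%:R - N%:R.
  have r0 : r != 0 by rewrite subr_eq0 eqr_nat gtn_eqF // ltnW.
  have r1 : 1 - r != 0.
    by rewrite /r opprB addrA nat1r subr_eq0 eqr_nat ltn_eqF.
  have [d [_ Hd]] := null_slice (null_lin 1 1 Hm
     (null_lin (- (1 - r)) (- r) HN HN1)).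
  exists (fun w t => - (r * (1 - r))^-1 * d w t).
  apply: null_ext (nullZ (- (r * (1 - r))^-1) (Hd (dir a b m))) => w t.
  transitivity (- (r * (1 - r))^-1 *
    (slice (dir a b m) (fun w t => -1 * lmul (opp_dir m) am w t +
       (1 - r) * lmul (opp_dir N) al w t + r * lmul (opp_dir N.+1) al1 w t) w t
       - lmul (dir a b m) d w t)).
    congr (_ * (_ - _)); apply: eq_bigr => j _; congr (_ * _).
    rewrite -natr1 /r; ring.
  rewrite slice_lmul3 !dd -natr1.
  have -> : lmul (dir a b m) (fun w t => - (r * (1 - r))^-1 * d w t) w t =
    - (r * (1 - r))^-1 * lmul (dir a b m) d w t by case: w => [|l w] /=; ring.
  rewrite /r; field.
  by apply/andP.
exists al; split=> // j.
(* As [opp_dir N.+1 - opp_dir N] is [evec a], the difference of the two relations gives the slice at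
   [a]; [N] times the result minus the relation for [N] then gives the slice at [b]. *)
have Ha : null s (fun w t => beta (a :: w) t - lmul (evec a) al w t).
  apply: null_ext (null_lin 1 1 (null_lin 1 (-1) HN1 HN)
     (nullZ (-1) (K (opp_dir N.+1)))) => w t.
  rewrite /opp_dir -natr1; case: w => [|l w] /=; ring.
have [-> //|ja] := eqVneq j a; have [->|jb] := eqVneq j b; last exact: Hj.
apply: null_ext (null_lin N%:R (-1) Ha HN) => w t.
rewrite /opp_dir; case: w => [|l w] /=; ring.
Qed.

Lemma dir_real a b m : realv (dir a b m).
Proof. by apply: realv_lin; rewrite ?realn ?real1 //; apply: realv_evec. Qed.

Lemma dot_dir_neq0 a b m : a != b -> dot (dir a b m) (dir a b m) != 0.
Proof.
move=> ab; apply/eqP => /(dot_eq0 (@dir_real a b m)) /(_ a) /eqP.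
by rewrite /dir /evec eqxx (negbTE ab) mulr0 addr0 mulr1 oner_eq0.
Qed.

Lemma dotZ r x : dot (fun i => r * x i) (fun i => r * x i) = r ^+ 2 * dot x x.
Proof. by rewrite /dot mulr_sumr; apply: eq_bigr => i _; ring. Qed.

Lemma sliceZ r x psi w t : slice (fun i => r * x i) psi w t = r * slice x psi w t.
Proof. by rewrite /slice mulr_sumr; apply: eq_bigr => i _; ring. Qed.

(* For [x] orthogonal to [x0], induction gives [slice x psi = x b_x] in the
   quotient, and comparing at orthogonal vectors shows that [b_x] is constant. *)
Lemma null_chain_orth s x0 psi : realv x0 -> dot x0 x0 != 0 ->
    (forall xs, chain s xs -> dot x0 (hdv xs) = 0 -> W0 (ev xs psi)) ->
  exists phi, null s (fun w t => psi w t - lmul x0 phi w t).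
Proof.
elim: s x0 psi => [|c s IHs] x0 psi rx0 x00 H.
  exists (fun _ _ => 0); apply: null_nil_ext (H [::] _ _) => //= [t|].
    by rewrite subr0.
  by rewrite dotC dot0l.
(* When the head is unconstrained, the induction hypothesis applies to every [dir a b m], and
   [null_dir] concludes. *)
have U phi : (forall xs, chain s xs -> W0 (ev xs phi)) -> null s phi.
  move=> Hphi; pose a := Ordinal (ltnW n_gt1); pose b := Ordinal n_gt1.
  have ab : a != b by [].
  apply: (@null_dir s 0 a b) => // m _; apply: IHs; first exact: dir_real.
    exact: dot_dir_neq0.
  by move=> xs ? _; apply: Hphi.
have Hb x : realv x -> dot x0 x = 0 -> dot x x != 0 -> exists b,
    (capped c s \/ forall w t, b w t = 0) /\
    null s (fun w t => slice x psi w t - lmul x b w t).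
  move=> rx x0x xx; pose r := sqrtC (dot x x).
  have r0 : r != 0 by rewrite sqrtC_eq0.
  have rr : r \is Num.real by rewrite ger0_real // sqrtC_ge0 dot_ge0.
  pose x1 : vec := fun i => r^-1 * x i.
  have rx1 : realv x1 by move=> i; rewrite realM ?realV.
  have x11 : dot x1 x1 = 1 by rewrite dotZ exprVn sqrtCK mulVf.
  have x0x1 : dot x0 x1 = 0.
    rewrite dotC /dot /x1; under eq_bigr do rewrite -mulrA.
    by rewrite -mulr_sumr -/(dot x x0) dotC x0x mulr0.
  have Hx1 xs : chain s xs -> (capped c s -> dot x1 (hdv xs) = 0) -> W0 (ev xs (slice x1 psi)).
    by move=> sxs cxs; apply: (H (x1 :: xs)).
  (* If a contraction is allowed, the rest of the chain must start orthogonally to [x1], which takes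
     the role of [x0] in the induction; otherwise the rest is arbitrary and [U] applies. *)
  have [cs|cs] := boolP (capped c s).
    have [|b Hb] := IHs x1 (slice x1 psi) rx1 _ (fun xs h1 h2 => Hx1 xs h1 (fun=> h2)).
      by rewrite x11 oner_eq0.
    exists b; split; [by left|apply: null_ext (nullZ r Hb) => w t].
    rewrite sliceZ mulrBr mulVKf //; congr (_ - _).
    by case: w => [|l w] /=; rewrite ?mulr0 // /x1 -mulrA mulVKf.
  exists (fun _ _ => 0); split; [by right|].
  have Hx : null s (slice x1 psi).
    by apply: U => xs h1; apply: Hx1 => //; rewrite (negbTE cs).
  apply: null_ext (nullZ r Hx) => w t; rewrite sliceZ.
  by rewrite mulVKf //; case: w => [|l w] /=; ring.
have [i x0i] := dot_neq0 rx0 x00.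
have [y [/(_ rx0) ry [j yj] yx0]] := ex_orth x0i.
have yy : dot y y != 0 by apply: contra_neq yj => /(dot_eq0 ry).
have [b [okb Hby]] := Hb y ry (etrans (dotC _ _) yx0) yy.
have {}Hb x : realv x -> dot x0 x = 0 ->
    null s (fun w t => slice x psi w t - lmul x b w t).
  (* Here [x] is [k * y + z] with [z] orthogonal to both [x0] and [y]; by linearity only [z]
     matters. *)
  move=> rx x0x; pose k := dot x y / dot y y.
  have rk : k \is Num.real by rewrite realM ?realV ?real_dot.
  pose z : vec := fun i => 1 * x i + - k * y i.
  have rz : realv z by apply: realv_lin => //; rewrite ?real1 ?realN.
  have zy : dot z y = 0 by rewrite dot_linl mul1r mulNr /k divfK // subrr.
  have x0z : dot x0 z = 0 by rewrite dotC dot_linl yx0 dotC x0x; ring.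
  have Ex w t (F : vec -> form) :
    (forall a b x y w t, F (fun i => a * x i + b * y i) w t = a * F x w t + b * F y w t) ->
    F x w t = k * F y w t + F z w t.
    by move=> FE; rewrite FE; ring.
  suff Hz : null s (fun w t => slice z psi w t - lmul z b w t).
    apply: null_ext (null_lin k 1 Hby Hz) => w t.
    rewrite (Ex w t (slice^~ psi)); last by move=> *; rewrite slice_lin.
    by rewrite (Ex w t (lmul^~ b)) => [|*]; [ring | rewrite lmul_lin].
  (* In dimension 2 only the first case occurs. In the second, the terms at [y], [z] and [y + z] are
     compared, with [x0] as the third orthogonal direction needed by [lmul_orth_inj]. *)
  have [zz|zz] := eqVneq (dot z z) 0.
    have z0 := dot_eq0 rz zz.
    apply: null_ext (null0 _) => w t; rewrite /slice big1 => [|l _]; last by rewrite z0 mul0r.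
    by case: w => [|l w] /=; rewrite ?z0; ring.
  have [bz [okz Hbz]] := Hb z rz x0z zz.
  pose v : vec := fun i => 1 * y i + 1 * z i.
  have rv : realv v by apply: realv_lin => //; rewrite real1.
  have x0v : dot x0 v = 0 by rewrite dotC dot_linl yx0 dotC x0z; ring.
  have vv : dot v v != 0.
    have Ev u : dot v u = 1 * dot y u + 1 * dot z u by apply: dot_linl.
    have -> : dot v v = dot y y + dot z z.
      by rewrite Ev !(dotC _ v) !Ev (dotC y z) zy; ring.
    by rewrite paddr_eq0 ?dot_ge0 // negb_and yy.
  have [bv [okv Hbv]] := Hb v rv x0v vv.
  have D : null s (fun w t => lmul y (fun w t => bv w t - b w t) w t +
                              lmul z (fun w t => bv w t - bz w t) w t).
    apply: null_ext (null_lin (-1) 1 Hbv (null_lin 1 1 Hby Hbz)) => w t.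
    by rewrite /v slice_lin; case: w => [|l w] /=; ring.
  suff K : null s (lmul z (fun w t => bz w t - b w t)).
    apply: null_ext (null_lin 1 1 Hbz K) => w t.
    by case: w => [|l w] /=; ring.
  have [cs|cs] := boolP (capped c s); last first.
    case: okb okz => [h|b0] [h1|bz0]; try by rewrite ?h ?h1 in cs.
    by apply: null_ext (null0 _) => -[|l w] t //=; rewrite b0 bz0; ring.
  have [c' [s' Es]] : exists c' s', s = c' :: s' by case: (s) cs => // c' s'; exists c', s'.
  subst s; apply: null_lmul.
  have D1 := lmul_orth_inj x0i (etrans (dotC _ _) yx0) x0z (etrans (dotC _ _) zy) yy D.
  have D2 : null s' (fun w t => bv w t - bz w t).
    apply: lmul_orth_inj x0i x0z (etrans (dotC _ _) yx0) zy zz (null_ext _ D) => w t.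
    by rewrite addrC.
  by apply: null_ext (null_lin 1 (-1) D1 D2) => w t; ring.
(* With this choice the slice of [psi - lmul x0 phi] by [x0] is exactly [lmul x0 b]; only the part
   [z] of [evec l] orthogonal to [x0] remains. *)
exists (fun w t => (dot x0 x0)^-1 * (slice x0 psi w t - lmul x0 b w t)).
apply: (null_of_slice okb) => l.
pose z : vec := fun i => 1 * evec l i + - (x0 l / dot x0 x0) * x0 i.
have rz : realv z.
  apply: realv_lin => //; rewrite ?real1 ?realN ?realM ?realV ?real_dot //.
  exact: realv_evec.
have x0z : dot x0 z = 0.
  by rewrite dotC dot_linl [dot (evec _) _]dotC dot_evec mul1r mulNr divfK // subrr.
apply: null_ext (Hb z rz x0z) => w t.
rewrite slice_lin lmul_lin.
have -> : slice (evec l) (fun w t => psi w t -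
    lmul x0 (fun w t => (dot x0 x0)^-1 * (slice x0 psi w t - lmul x0 b w t)) w t) w t =
    psi (l :: w) t - x0 l * ((dot x0 x0)^-1 * (slice x0 psi w t - lmul x0 b w t)).
  by rewrite slice_evec.
by rewrite slice_evec; ring.
Qed.

(** The hypothesis restricts to the chains whose head is orthogonal to a given [dir a b m], so [psi]
    is null up to a tensor with that first factor, for every [m]; [null_dir] removes the factor. *)
Lemma null_chain s psi : (forall xs, chain s xs -> W0 (ev xs psi)) -> null s psi.
Proof.
move=> Hpsi; pose a := Ordinal (ltnW n_gt1); pose b := Ordinal n_gt1.
have ab : a != b by [].
apply: (@null_dir s 0 a b) => // m _; apply: null_chain_orth.
- exact: dir_real.
- exact: dot_dir_neq0.
- by move=> xs ? _; apply: Hpsi.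
Qed.

End Values.
End Chains.

(** * Leading coefficients *)

Section WordSum.
Variables (V : nmodType) (T : finType).

(** The sum over words of length [k], by recursion on the first letter so as to unfold together with
    [null] and [ev]. *)
Fixpoint wsum k (F : seq T -> V) : V :=
  if k is k'.+1 then \sum_t wsum k' (fun w => F (t :: w)) else F [::].

Lemma eq_wsum k F1 F2 : (forall w, size w = k -> F1 w = F2 w) ->
  wsum k F1 = wsum k F2.
Proof.
elim: k F1 F2 => [|k IHk] F1 F2 E /=; first exact: E.
by apply: eq_bigr => t _; apply: IHk => w sw; apply: E; rewrite /= sw.
Qed.

Lemma wsum_closed (P : V -> Prop) k F : P 0 -> (forall x y, P x -> P y -> P (x + y)) ->
  (forall w, size w = k -> P (F w)) -> P (wsum k F).
Proof.
move=> P0 PD; elim: k F => [|k IHk] F PF /=; first exact: PF.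
by apply: big_ind => // t _; apply: IHk => w sw; apply: PF; rewrite /= sw.
Qed.

Lemma wsum_eq0 k F : (forall w, size w = k -> F w = 0) -> wsum k F = 0.
Proof.
by apply: (wsum_closed (P := fun x => x = 0)) => // x y -> ->; rewrite addr0.
Qed.

Lemma wsumD k F1 F2 : wsum k (fun w => F1 w + F2 w) = wsum k F1 + wsum k F2.
Proof.
elim: k F1 F2 => //= k IHk F1 F2; rewrite -big_split.
by apply: eq_bigr => t _; apply: IHk.
Qed.

Lemma wsum_sum (I : Type) (r : seq I) k (F : I -> seq T -> V) :
  wsum k (fun w => \sum_(i <- r) F i w) = \sum_(i <- r) wsum k (F i).
Proof.
elim: k F => //= k IHk F; rewrite exchange_big /=.
by apply: eq_bigr => t _; apply: IHk.
Qed.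
End WordSum.

Lemma wsum_morph (V V' : nmodType) (T : finType) (f : V -> V') k (F : seq T -> V) :
  f 0 = 0 -> {morph f : x y / x + y} -> f (wsum k F) = wsum k (fun w => f (F w)).
Proof.
move=> f0 fD; elim: k F => //= k IHk F.
by rewrite (big_morph f fD f0); apply: eq_bigr => t _; apply: IHk.
Qed.

Lemma exchange_wsum (V : nmodType) (T1 T2 : finType) k1 k2 (F : seq T1 -> seq T2 -> V) :
  wsum k1 (fun w1 => wsum k2 (F w1)) = wsum k2 (fun w2 => wsum k1 (F^~ w2)).
Proof.
elim: k1 F => //= k1 IHk F; rewrite wsum_sum.
by apply: eq_bigr => t _; apply: IHk.
Qed.

Lemma wsum_zip (V : nmodType) (T1 T2 : finType) k (F : seq (T1 * T2) -> V) :
  wsum k F = wsum k (fun w1 => wsum k (fun w2 => F (zip w1 w2))).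
Proof.
elim: k F => //= k IHk F.
rewrite (eq_bigr (fun p => wsum k (fun w => F ((p.1, p.2) :: w)))) => [|[]//].
rewrite -(pair_bigA _ (fun t1 t2 => wsum k (fun w => F ((t1, t2) :: w)))) /=.
apply: eq_bigr => t1 _; rewrite wsum_sum; apply: eq_bigr => t2 _; exact: IHk.
Qed.

Lemma wsum_delta (R : pzSemiRingType) (V : lSemiModType R) (T : finType)
    (w0 : seq T) (F : seq T -> V) :
  wsum (size w0) (fun w => (w == w0)%:R *: F w) = F w0.
Proof.
elim: w0 F => [|t w0 IHw] F /=; first by rewrite scale1r.
rewrite (bigD1 t) //= -[RHS](IHw (fun w => F (t :: w))) big1 ?addr0.
  by apply: eq_wsum => w _; rewrite eqseq_cons eqxx.
by move=> u /negbTE ut; apply: wsum_eq0 => w _; rewrite eqseq_cons ut scale0r.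
Qed.

(** * From null forms to relations in a module *)

Section Elimination.
Variables (C : numClosedFieldType) (n : nat) (G : Type) (adj : rel G).
Variables (T : Type) (W0 : (T -> C) -> Prop) (M : lmodType C) (M0 : M -> Prop).
Hypothesis M00 : M0 0.
Hypothesis M0D : forall x y, M0 x -> M0 y -> M0 (x + y).
Variables (s0 : seq G) (F : seq 'I_n -> (T -> C) -> M).
Hypothesis F_lin : forall w (a b : C) f g,
  F w (fun t => a * f t + b * g t) = a *: F w f + b *: F w g.
Hypothesis F_W0 : forall w f, size w = size s0 -> W0 f -> M0 (F w f).
Hypothesis F_cap : forall s1 c c' s2 w1 w2 f,
  s0 = s1 ++ c :: c' :: s2 -> adj c c' -> size w1 = size s1 -> size w2 = size s2 ->
  M0 (\sum_j F (w1 ++ j :: j :: w2) f).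

(** The letters already read are in [pre]. At each letter, [psi] is split into its difference with
    the contraction tensor, treated by induction, and that tensor, whose sum consists of terms
    covered by [F_cap]. *)
Lemma null_elim s s1 pre psi : s0 = s1 ++ s -> size pre = size s1 ->
  null adj W0 s psi -> M0 (wsum (size s) (fun w => F (pre ++ w) (psi w))).
Proof.
elim: s s1 pre psi => [|c s IHs] s1 pre psi Es spre /=.
  by move=> H; apply: F_W0 H; rewrite Es !cats0.
move=> [phi [ok H]].
have F0 w : F w (fun=> 0) = 0.
  have := F_lin w 0 0 (fun=> 0) (fun=> 0); rewrite !scale0r addr0 => <-.
  by congr F; apply/funext => t; rewrite mul0r addr0.
have -> : \sum_t wsum (size s) (fun w => F (pre ++ t :: w) (psi (t :: w))) =
    (\sum_j wsum (size s) (fun w => F (rcons pre j ++ w)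
       (fun t => psi (j :: w) t - lmul (evec C j) phi w t))) +
    \sum_j wsum (size s) (fun w => F (pre ++ j :: w) (lmul (evec C j) phi w)).
  rewrite -big_split; apply: eq_bigr => j _ /=; rewrite -wsumD; apply: eq_wsum => w _.
  rewrite cat_rcons -[X in X + _]scale1r -[X in _ + X]scale1r -F_lin.
  by congr F; apply/funext => t; ring.
apply: M0D; first apply: big_ind => // j _.
  by apply: (IHs (rcons s1 c)); rewrite ?cat_rcons ?size_rcons ?spre.
case: ok => [cs|phi0]; last first.
  rewrite big1 // => j _; apply: wsum_eq0 => w _; rewrite -[RHS](F0 (pre ++ j :: w)).
  by congr F; apply/funext => t; case: w => [|l w] //=; rewrite phi0 mulr0.
case: s cs Es {IHs H} => // c' s cs Es.
have -> : \sum_j wsum (size (c' :: s)) (fun w => F (pre ++ j :: w) (lmul (evec C j) phi w)) =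
    wsum (size s) (fun w => \sum_j F (pre ++ j :: j :: w) (phi w)).
  rewrite wsum_sum; apply: eq_bigr => j _ /=.
  rewrite (bigD1 j) //= big1 => [|l lj].
    rewrite addr0; apply: eq_wsum => w _; congr F; apply/funext => t.
    by rewrite /= /evec eqxx mul1r.
  apply: wsum_eq0 => w _; rewrite -[RHS](F0 (pre ++ j :: l :: w)); congr F.
  by apply/funext => t; rewrite /= /evec (negbTE lj) mul0r.
by apply: wsum_closed => // w sw; apply: (F_cap _ Es).
Qed.

End Elimination.

(** * Filtration by word length *)

Section Degree.
Variables (C : numClosedFieldType) (n : nat) (G : finType) (adj : rel G).
Variables (A : algType C) (v : G -> 'I_n -> 'I_n -> A).
Local Notation letter := (G * ('I_n * 'I_n))%type.

Definition mono (w : seq letter) : A := \prod_(l <- w) v l.1 l.2.1 l.2.2.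

(** The span of the words of length less than [k], peeled off one length at a time from the
    longest. *)
Fixpoint deg_lt k (a : A) : Prop :=
  if k is k'.+1 then exists alpha : seq letter -> C,
    deg_lt k' (a - wsum k' (fun w => alpha w *: mono w))
  else a = 0.

Lemma deg_lt_lin k x y a b : deg_lt k a -> deg_lt k b -> deg_lt k (x *: a + y *: b).
Proof.
elim: k a b => [|k IHk] a b /=; first by move=> -> ->; rewrite !scaler0 addr0.
move=> [al Ha] [be Hb]; exists (fun w => x * al w + y * be w).
have -> : wsum k (fun w => (x * al w + y * be w) *: mono w) =
    x *: wsum k (fun w => al w *: mono w) + y *: wsum k (fun w => be w *: mono w).
  rewrite (wsum_morph _ _ (scaler0 _ x) (scalerDr x)).
  rewrite (wsum_morph _ _ (scaler0 _ y) (scalerDr y)) -wsumD.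
  by apply: eq_wsum => w _; rewrite !scalerA scalerDl.
by rewrite opprD addrACA -!scalerBr; apply: IHk.
Qed.

Lemma deg_ltD k a b : deg_lt k a -> deg_lt k b -> deg_lt k (a + b).
Proof. by move=> Ha Hb; have := deg_lt_lin 1 1 Ha Hb; rewrite !scale1r. Qed.

Lemma deg_lt0 k : deg_lt k 0.
Proof.
elim: k => //= k IHk; exists (fun=> 0); rewrite wsum_eq0 ?subrr // => w _.
by rewrite scale0r.
Qed.

Lemma deg_ltZ k x a : deg_lt k a -> deg_lt k (x *: a).
Proof.
by move=> Ha; have := deg_lt_lin x 0 Ha (deg_lt0 k); rewrite scaler0 addr0.
Qed.

Lemma deg_ltS k a : deg_lt k a -> deg_lt k.+1 a.
Proof.
move=> Ha; exists (fun=> 0); rewrite wsum_eq0 ?subr0 // => w _; exact: scale0r.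
Qed.

Lemma deg_lt_le k k' a : (k <= k')%N -> deg_lt k a -> deg_lt k' a.
Proof.
elim: k' => [|k' IHk]; first by rewrite leqn0 => /eqP ->.
by rewrite leq_eqVlt ltnS => /orP[/eqP -> //|/IHk H] /H /deg_ltS.
Qed.

Lemma deg_lt_mono k w : (size w < k)%N -> deg_lt k (mono w).
Proof.
move=> H; apply: deg_lt_le H _; exists (fun w' => (w' == w)%:R).
by rewrite wsum_delta subrr; apply: deg_lt0.
Qed.

Lemma mono_cat w1 w2 : mono (w1 ++ w2) = mono w1 * mono w2.
Proof. by rewrite /mono big_cat. Qed.

Hypothesis v_row : forall c c', adj c c' -> forall a b,
  \sum_j v c j a * v c' j b = (a == b)%:R.
Hypothesis v_col : forall c c', adj c c' -> forall a b,
  \sum_j v c a j * v c' b j = (a == b)%:R.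

Definition mon s I J := mono (zip s (zip I J)).

Lemma mon_cat s1 c c' s2 (I1 I2 J1 J2 : seq 'I_n) i i' j j' :
  size I1 = size s1 -> size J1 = size s1 ->
  mon (s1 ++ c :: c' :: s2) (I1 ++ i :: i' :: I2) (J1 ++ j :: j' :: J2) =
  mon s1 I1 J1 * (v c i j * v c' i' j') * mon s2 I2 J2.
Proof.
move=> sI sJ; rewrite /mon zip_cat ?sI ?sJ // zip_cat ?size_zip ?sI ?sJ ?minnn //.
by rewrite mono_cat /mono /= !big_cons /= !mulrA.
Qed.

Lemma cat2_split (T : Type) k1 k2 (w : seq T) : size w = (k1 + k2.+2)%N ->
  exists w1 a b w2, [/\ w = w1 ++ a :: b :: w2, size w1 = k1 & size w2 = k2].
Proof.
move=> sw; have := size_drop k1 w; rewrite sw addKn.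
case E : (drop k1 w) => [|a [|b w2]] //= [s2].
exists (take k1 w), a, b, w2; rewrite -E cat_take_drop size_takel // sw.
exact: leq_addr.
Qed.

(** A contraction replaces two letters by a scalar, so the word becomes shorter by two. *)
Lemma deg_lt_cancel s1 c c' s2 I1 I2 J1 J2 (b : bool) :
  size I1 = size s1 -> size J1 = size s1 ->
  deg_lt (size (s1 ++ c :: c' :: s2)) (mon s1 I1 J1 * b%:R * mon s2 I2 J2).
Proof.
move=> sI sJ; case: b; last by rewrite mulr0 mul0r; apply: deg_lt0.
rewrite mulr1 -mono_cat; apply: deg_lt_mono.
rewrite !size_cat !size_zip sI sJ minnn minnn /= !addnS.
by rewrite ltnS (leq_trans _ (leqnSn _)) // leq_add2l geq_minl.
Qed.

Lemma deg_lt_row s1 c c' s2 I1 I2 J : adj c c' ->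
  size I1 = size s1 -> size I2 = size s2 -> size J = size (s1 ++ c :: c' :: s2) ->
  deg_lt (size (s1 ++ c :: c' :: s2))
    (\sum_j mon (s1 ++ c :: c' :: s2) (I1 ++ j :: j :: I2) J).
Proof.
move=> cc' sI1 sI2; rewrite [in X in X -> _]size_cat => /cat2_split[J1 [a [b [J2 [-> sJ1 sJ2]]]]].
have -> : \sum_j mon (s1 ++ c :: c' :: s2) (I1 ++ j :: j :: I2) (J1 ++ a :: b :: J2) =
    mon s1 I1 J1 * (a == b)%:R * mon s2 I2 J2.
  rewrite -(v_row cc') mulr_sumr mulr_suml.
  by apply: eq_bigr => j _; rewrite mon_cat.
exact: deg_lt_cancel.
Qed.

Lemma deg_lt_col s1 c c' s2 I J1 J2 : adj c c' ->
  size J1 = size s1 -> size J2 = size s2 -> size I = size (s1 ++ c :: c' :: s2) ->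
  deg_lt (size (s1 ++ c :: c' :: s2))
    (\sum_j mon (s1 ++ c :: c' :: s2) I (J1 ++ j :: j :: J2)).
Proof.
move=> cc' sJ1 sJ2; rewrite [in X in X -> _]size_cat => /cat2_split[I1 [a [b [I2 [-> sI1 sI2]]]]].
have -> : \sum_j mon (s1 ++ c :: c' :: s2) (I1 ++ a :: b :: I2) (J1 ++ j :: j :: J2) =
    mon s1 I1 J1 * (a == b)%:R * mon s2 I2 J2.
  rewrite -(v_col cc') mulr_sumr mulr_suml.
  by apply: eq_bigr => j _; rewrite mon_cat.
exact: deg_lt_cancel.
Qed.

Hypothesis n_gt1 : (1 < n)%N.

(** [null_chain] is used twice: on the row indices, with values in functions of the column indices
    modulo null ones, then on the column indices with scalar values. [null_elim] follows the same
    two levels, with [v_row] and then [v_col] as the contractions. *)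
Lemma deg_lt_top s (alpha : seq 'I_n -> seq 'I_n -> C) :
    (forall xs ys, chain adj s xs -> chain adj s ys ->
      ev ys (fun J (_ : unit) => ev xs alpha J) tt = 0) ->
  deg_lt (size s) (wsum (size s) (fun I => wsum (size s) (fun J =>
    alpha I J *: mon s I J))).
Proof.
move=> H.
pose W1 (g : unit -> C) := g tt = 0.
have W10 : W1 (fun=> 0) by [].
have W1_lin a b f g : W1 f -> W1 g -> W1 (fun t => a * f t + b * g t).
  by rewrite /W1 => -> ->; ring.
pose W0 (f : seq 'I_n -> C) := null adj W1 s (fun J (_ : unit) => f J).
have W00 : W0 (fun=> 0) by apply: null0.
have W0_lin a b f g : W0 f -> W0 g -> W0 (fun t => a * f t + b * g t).
  exact: null_lin.
have Halpha : null adj W0 s alpha.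
  apply: null_chain => // xs cxs; apply: null_chain => // ys cys; exact: H.
pose F I (f : seq 'I_n -> C) := wsum (size s) (fun J => f J *: mon s I J).
have lin (k1 k2 : C) I f1 f2 :
    wsum (size s) (fun J => (k1 * f1 J + k2 * f2 J) *: mon s I J) =
    k1 *: F I f1 + k2 *: F I f2.
  rewrite (wsum_morph _ _ (scaler0 _ k1) (scalerDr k1)).
  rewrite (wsum_morph _ _ (scaler0 _ k2) (scalerDr k2)) -wsumD.
  by apply: eq_wsum => w _; rewrite !scalerA scalerDl.
refine (@null_elim _ _ _ adj _ W0 _ (deg_lt (size s)) (deg_lt0 _) (@deg_ltD _) s F
  _ _ _ s [::] [::] alpha erefl erefl Halpha).
- by move=> I k1 k2 f1 f2; apply: lin.
- move=> I f sI Hf.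
  refine (@null_elim _ _ _ adj _ W1 _ (deg_lt (size s)) (deg_lt0 _) (@deg_ltD _) s
    (fun J g => g tt *: mon s I J) _ _ _ s [::] [::] (fun J _ => f J) erefl erefl Hf).
  + by move=> w a b f1 f2; rewrite !scalerA scalerDl.
  + by move=> w g _ ->; rewrite scale0r; apply: deg_lt0.
  + move=> s1 c c' s2 w1 w2 g Es cc' s1w s2w; rewrite -scaler_sumr.
    by apply: deg_ltZ; rewrite Es; apply: deg_lt_col; rewrite // -Es.
- move=> s1 c c' s2 w1 w2 f Es cc' s1w s2w; rewrite /F -wsum_sum.
  apply: wsum_closed => [||w sw]; [exact: deg_lt0|exact: deg_ltD|].
  rewrite -scaler_sumr; apply: deg_ltZ; rewrite Es.
  by apply: deg_lt_row; rewrite // -Es.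
Qed.

End Degree.

(** * Evaluation on chains as weights of words *)

Section Weights.
Variables (C : numClosedFieldType) (n : nat).
Local Notation vec := ('I_n -> C).

Fixpoint weight (xs : seq vec) (I : seq 'I_n) : C :=
  match xs, I with x :: xs', i :: I' => x i * weight xs' I' | _, _ => 1 end.

Lemma ev_weight (T : Type) xs (psi : seq 'I_n -> T -> C) t :
  ev xs psi t = wsum (size xs) (fun I => weight xs I * psi I t).
Proof.
elim: xs psi => [|x xs IHxs] psi /=; first by rewrite mul1r.
rewrite IHxs -wsum_sum; apply: eq_wsum => I _; rewrite /slice mulr_sumr.
by apply: eq_bigr => i _; ring.
Qed.

Variables (G : finType).
Local Notation letter := (G * ('I_n * 'I_n))%type.

(** The matrix coefficient that a path representation should have at a word as long as the path. *)
Fixpoint path_weight (s : seq G) (xs ys : seq vec) (w : seq letter) : C :=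
  match s, xs, ys, w with
  | c :: s', x :: xs', y :: ys', l :: w' =>
      (l.1 == c)%:R * x l.2.1 * y l.2.2 * path_weight s' xs' ys' w'
  | _, _, _, _ => 1
  end.

Lemma path_weight_zip s xs ys s' I J : size xs = size s -> size ys = size s ->
  size s' = size s -> size I = size s -> size J = size s ->
  path_weight s xs ys (zip s' (zip I J)) = (s' == s)%:R * (weight xs I * weight ys J).
Proof.
elim: s xs ys s' I J => [|c s IHs] [|x xs] [|y ys] [|c' s'] [|i I] [|j J] //=.
  by move=> *; rewrite mul1r mulr1.
move=> [sx] [sy] [ss] [sI] [sJ]; rewrite IHs // eqseq_cons.
by case: eqP => _; case: eqP => _ /=; ring.
Qed.

Variable adj : rel G.

Lemma size_chain s xs : chain (C := C) (n := n) adj s xs -> size xs = size s.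
Proof. by elim: s xs => [|c s IHs] [|x xs] //= [_ _ _ /IHs ->]. Qed.

Lemma wsum_path_weight s xs ys (alpha : seq letter -> C) :
  size xs = size s -> size ys = size s ->
  wsum (size s) (fun w => alpha w * path_weight s xs ys w) =
  ev ys (fun J (_ : unit) => ev xs (fun I J => alpha (zip s (zip I J))) J) tt.
Proof.
move=> sx sy; rewrite wsum_zip ev_weight sy.
under [RHS]eq_wsum => J _.
  rewrite ev_weight sx (wsum_morph _ _ (mulr0 _) (mulrDr (weight ys J))); over.
rewrite [RHS]exchange_wsum /=.
pose F s' := wsum (size s) (fun I => wsum (size s) (fun J =>
  weight xs I * weight ys J * alpha (zip s' (zip I J)))).
transitivity (wsum (size s) (fun s' => (s' == s)%:R * F s')).
  apply: eq_wsum => s' ss'; rewrite wsum_zip.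
  rewrite (wsum_morph _ _ (mulr0 _) (mulrDr _)); apply: eq_wsum => I sI.
  rewrite (wsum_morph _ _ (mulr0 _) (mulrDr _)); apply: eq_wsum => J sJ.
  rewrite path_weight_zip //; ring.
rewrite (wsum_delta (V := C^o)); apply: eq_wsum => I _; apply: eq_wsum => J _; ring.
Qed.

End Weights.

(** * Residual finiteness from path representations *)

Section Criterion.
Variables (C : numClosedFieldType) (n : nat) (G : finType) (adj : rel G).
Variables (A : starAlgType C) (v : G -> 'I_n -> 'I_n -> A).
Hypothesis n_gt1 : (1 < n)%N.
Hypothesis v_row : forall c c', adj c c' -> forall a b,
  \sum_j v c j a * v c' j b = (a == b)%:R.
Hypothesis v_col : forall c c', adj c c' -> forall a b,
  \sum_j v c a j * v c' b j = (a == b)%:R.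
Hypothesis v_gen : forall a, exists k, deg_lt v k a.
Hypothesis v_path : forall s xs ys,
  chain (C := C) (n := n) adj s xs -> chain adj s ys ->
  exists m (pi : {lrmorphism A -> 'M[C]_m.+1}) p q,
    [/\ {morph pi : x / star x},
        forall w, (size w < size s)%N -> pi (mono v w) p q = 0 &
        forall w, size w = size s -> pi (mono v w) p q = path_weight s xs ys w].

Lemma pi_wsum m (pi : {lrmorphism A -> 'M[C]_m.+1}) p q k alpha :
  pi (wsum k (fun w => alpha w *: mono v w)) p q =
  wsum k (fun w => alpha w * pi (mono v w) p q).
Proof.
rewrite (wsum_morph (f := fun a => pi a p q)).
- by apply: eq_wsum => w _; rewrite linearZ mxE.
- by rewrite raddf0 mxE.
- by move=> a b; rewrite raddfD mxE.
Qed.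

Lemma RFD_of_path : RFD A.
Proof.
move=> a a0; apply: contrapT => Ha.
have {}Ha m (pi : {lrmorphism A -> 'M[C]_m.+1}) : {morph pi : x / star x} -> pi a = 0.
  by move=> piS; apply/eqP; apply: contraT => pa; case: Ha; exists m, pi.
have [k] := v_gen a; elim: k => [/eqP|k IHk [alpha Hb]]; first exact/negP.
(* It is enough that [top], the part of length exactly [k], has degree less than [k]; this is shown
   for one colour pattern [s] at a time. *)
apply: IHk; set top := wsum k _ in Hb; rewrite -(subrK top a).
apply: deg_ltD => //.
rewrite /top wsum_zip; apply: wsum_closed => [||s ss].
- exact: deg_lt0.
- exact: deg_ltD.
rewrite wsum_zip -ss.
apply: (deg_lt_top v_row v_col n_gt1 (alpha := fun I J => alpha (zip s (zip I J)))).
move=> xs ys cx cy; rewrite -wsum_path_weight ?(size_chain cx) ?(size_chain cy) //.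
have [m [pi [p [q [piS pi_lt pi_eq]]]]] := v_path cx cy.
transitivity (pi top p q).
  by rewrite pi_wsum ss; apply: eq_wsum => w sw; rewrite pi_eq // ss.
(* The entry [(p, q)] of [pi] vanishes on [a - top], whose words are shorter than [s], and on [a];
   hence on [top]. *)
have pi_low b j : (j <= k)%N -> deg_lt v j b -> pi b p q = 0.
  elim: j b => [|j IHj] b jk /=; first by move=> ->; rewrite raddf0 mxE.
  move=> [be /(IHj _ (ltnW jk))]; rewrite raddfB mxE [X in _ + X]mxE pi_wsum.
  rewrite wsum_eq0 ?subr0 // => w sw.
  by rewrite pi_lt ?mulr0 // sw ss.
have := pi_low _ k (leqnn k) Hb; rewrite raddfB /= (Ha _ _ piS) sub0r mxE.
by move/eqP; rewrite oppr_eq0 => /eqP.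
Qed.

End Criterion.

(** * Orthogonal completion *)

Section Reflections.
Variables (C : numClosedFieldType) (n : nat).
Implicit Types x y z w : 'cV[C]_n.

(** Bilinear rather than sesquilinear; the two agree on real vectors. *)
Definition ip x y : C := (x^T *m y) 0 0.
Definition real_mx m p (A : 'M[C]_(m, p)) := forall i j, A i j \is Num.real.

Lemma ipE x y : x^T *m y = (ip x y)%:M.
Proof. exact: mx11_scalar. Qed.

Lemma ipC x y : ip x y = ip y x.
Proof. by rewrite /ip -[x^T *m y]trmxK trmx_mul trmxK mxE. Qed.

Lemma ipB x y z : ip (x - y) z = ip x z - ip y z.
Proof. by rewrite /ip linearB mulmxBl !mxE. Qed.

Lemma ip_eq0 x : real_mx x -> ip x x = 0 -> x = 0.
Proof.
move=> rx; rewrite /ip mxE => /eqP; rewrite psumr_eq0 => [/allP H|i _]; last first.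
  by rewrite mxE -expr2 real_exprn_even_ge0.
apply/matrixP => i j; rewrite ord1 [RHS]mxE.
by have := H i (mem_index_enum i); rewrite mxE /= mulf_eq0 orbb => /eqP.
Qed.

Lemma real_mx_mul m p q (A : 'M[C]_(m, p)) (B : 'M[C]_(p, q)) :
  real_mx A -> real_mx B -> real_mx (A *m B).
Proof. by move=> rA rB i j; rewrite mxE; apply: sum_real => k _; rewrite realM. Qed.

Lemma real_mxB m p (A B : 'M[C]_(m, p)) : real_mx A -> real_mx B -> real_mx (A - B).
Proof. by move=> rA rB i j; rewrite !mxE realB. Qed.

Lemma real_mx_tr m p (A : 'M[C]_(m, p)) : real_mx A -> real_mx A^T.
Proof. by move=> rA i j; rewrite mxE. Qed.

Lemma real_ip x y : real_mx x -> real_mx y -> ip x y \is Num.real.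
Proof. by move=> rx ry; apply: real_mx_mul => //; apply: real_mx_tr. Qed.

(* For [w = 0] the coefficient is [2 / 0 = 0], and this is the identity. *)
Definition refl w : 'M[C]_n := 1%:M - (2 / ip w w) *: (w *m w^T).

Lemma refl_tr w : (refl w)^T = refl w.
Proof. by rewrite /refl linearB /= trmx1 linearZ /= trmx_mul trmxK. Qed.

Lemma refl_mul w z : refl w *m z = z - (2 / ip w w * ip w z) *: w.
Proof.
rewrite /refl mulmxBl mul1mx -scalemxAl -mulmxA ipE mul_mx_scalar scalerA.
by rewrite mulrC.
Qed.

Lemma refl_invol w : refl w *m refl w = 1%:M.
Proof.
rewrite {2}/refl mulmxBr mulmx1 -scalemxAr mulmxA refl_mul mulmxBl -scalemxAl.
have [w0|w0] := eqVneq (ip w w) 0.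
  by rewrite w0 !(invr0, mulr0, scale0r, subr0) /refl w0 invr0 mulr0 scale0r subr0.
rewrite divfK // scaler_nat mulr2n opprD addrA subrr sub0r scalerN opprK.
by rewrite /refl subrK.
Qed.

Lemma real_mx_refl w : real_mx w -> real_mx (refl w).
Proof.
move=> rw; apply: real_mxB => i j; first by rewrite mxE realn.
rewrite mxE realM ?realM ?realV ?real_ip ?realn //.
by apply: real_mx_mul => //; apply: real_mx_tr.
Qed.

(** For [w = y - x], equal norms give [ip w w = 2 * ip w y], so the reflection subtracts exactly [w]
    from [y]. *)
Lemma refl_swap x y : real_mx x -> real_mx y -> ip x x = ip y y ->
  refl (y - x) *m y = x.
Proof.
move=> rx ry xy; rewrite refl_mul.
have E : ip (y - x) (y - x) = 2 * ip (y - x) y.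
  by rewrite !ipB ![ip _ (y - x)]ipC !ipB xy (ipC x y); ring.
have [/(ip_eq0 (real_mxB ry rx)) /subr0_eq ->|w0] := eqVneq (ip (y - x) (y - x)) 0.
  by rewrite subrr scaler0 subr0.
have -> : 2 / ip (y - x) (y - x) * ip (y - x) y = 1.
  by rewrite mulrAC -E mulfV.
by rewrite scale1r subKr.
Qed.

Lemma refl_orth w z : ip w z = 0 -> refl w *m z = z.
Proof. by rewrite refl_mul => ->; rewrite mulr0 scale0r subr0. Qed.

(* An orthogonal matrix sending [y] to [x] and [y'] to [x']. *)
Definition witt x x' y y' : 'M[C]_n :=
  refl (refl (y - x) *m y' - x') *m refl (y - x).

Section Witt.
Variables x x' y y' : 'cV[C]_n.
Hypotheses (rx : real_mx x) (rx' : real_mx x') (ry : real_mx y) (ry' : real_mx y').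
Hypotheses (xy : ip x x = ip y y) (xy' : ip x' x' = ip y' y') (xxyy : ip x x' = ip y y').

Let w := y - x.
Let y1 := refl w *m y'.

Let ip_refl z z' : ip (refl w *m z) (refl w *m z') = ip z z'.
Proof. by rewrite /ip trmx_mul refl_tr -mulmxA (mulmxA (refl w)) refl_invol mul1mx. Qed.

Let ry1 : real_mx y1.
Proof. by apply: real_mx_mul => //; apply/real_mx_refl/real_mxB. Qed.

(** The first reflection sends [y] to [x], and the second fixes [x] because by [xxyy] its vector is
    orthogonal to [x]. *)
Lemma witt_l : witt x x' y y' *m y = x.
Proof.
rewrite /witt -mulmxA refl_swap // refl_orth // ipB (ipC x') xxyy.
by rewrite (ipC y) -(ip_refl y' y) refl_swap // subrr.
Qed.

Lemma witt_r : witt x x' y y' *m y' = x'.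
Proof. by rewrite /witt -mulmxA; apply: refl_swap; rewrite // xy' ip_refl. Qed.

Lemma real_mx_witt : real_mx (witt x x' y y').
Proof. by apply: real_mx_mul; apply: real_mx_refl; apply: real_mxB. Qed.

End Witt.

Lemma witt_orth x x' y y' : witt x x' y y' *m (witt x x' y y')^T = 1%:M.
Proof.
rewrite /witt trmx_mul !refl_tr mulmxA -(mulmxA (refl _)) refl_invol mulmx1.
exact: refl_invol.
Qed.

Definition defect x x' y y' : 'M[C]_n := witt x x' y y' - x *m y^T - x' *m y'^T.

(** If each pair of vectors is orthogonal and made of unit or zero vectors, a real such [N] is a
    partial isometry from the complement of [y], [y'] onto that of [x], [x']. *)
Record is_defect (N : 'M[C]_n) x x' y y' : Prop := IsDefect {
  defect_mulT : N *m N^T = 1%:M - x *m x^T - x' *m x'^T;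
  defect_Tmul : N^T *m N = 1%:M - y *m y^T - y' *m y'^T;
  defect_l : N *m y = 0; defect_r : N *m y' = 0;
  defect_Tl : N^T *m x = 0; defect_Tr : N^T *m x' = 0
}.

Lemma is_defect_tr N x x' y y' : is_defect N x x' y y' -> is_defect N^T y y' x x'.
Proof. by case=> *; split; rewrite ?trmxK. Qed.

(* Both vectors are unit vectors, or both are zero (an absent edge). *)
Record link x y : Prop := Link {
  link_rl : real_mx x; link_rr : real_mx y; link_ip : ip x x = ip y y;
  link_l : ip x x *: x = x; link_r : ip y y *: y = y
}.

Lemma link_sym x y : link x y -> link y x.
Proof. by case. Qed.

Lemma orth_defect (O : 'M[C]_n) x x' y y' : link x y -> link x' y' ->
    ip x x' = 0 -> ip y y' = 0 -> O *m O^T = 1%:M -> O *m y = x -> O *m y' = x' ->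
  is_defect (O - x *m y^T - x' *m y'^T) x x' y y'.
Proof.
move=> [rx ry xy xl yl] [rx' ry' xy' xl' yl'] xx yy OO Oy Oy'.
have OTO : O^T *m O = 1%:M by apply: mulmx1C.
have Ox : O^T *m x = y by rewrite -Oy mulmxA OTO mul1mx.
have Ox' : O^T *m x' = y' by rewrite -Oy' mulmxA OTO mul1mx.
set N := O - _ - _.
have Ny : N *m y = 0.
  rewrite /N !mulmxBl Oy -!mulmxA !ipE !mul_mx_scalar -xy xl (ipC y') yy.
  by rewrite scale0r subr0 subrr.
have Ny' : N *m y' = 0.
  rewrite /N !mulmxBl Oy' -!mulmxA !ipE !mul_mx_scalar -xy' xl' yy.
  by rewrite scale0r subr0 subrr.
have NT : N^T = O^T - y *m x^T - y' *m x'^T.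
  by rewrite /N !linearB /= !trmx_mul !trmxK.
have Nx : N^T *m x = 0.
  rewrite NT !mulmxBl Ox -!mulmxA !ipE !mul_mx_scalar xy yl (ipC x') xx.
  by rewrite scale0r subr0 subrr.
have Nx' : N^T *m x' = 0.
  rewrite NT !mulmxBl Ox' -!mulmxA !ipE !mul_mx_scalar xy' yl' xx.
  by rewrite scale0r subr0 subrr.
split=> //.
  rewrite NT !mulmxBr !mulmxA Ny Ny' !mul0mx !subr0 /N !mulmxBl OO.
  by rewrite -!(mulmxA _ _ O^T) -!trmx_mul Oy Oy'.
have xO : x^T *m O = y^T by rewrite -[O]trmxK -trmx_mul Ox.
have xO' : x'^T *m O = y'^T by rewrite -[O]trmxK -trmx_mul Ox'.
rewrite {2}/N !mulmxBr !mulmxA Nx Nx' !mul0mx !subr0 NT !mulmxBl OTO.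
by rewrite -!(mulmxA _ _ O) xO xO'.
Qed.

Lemma defectP x x' y y' : link x y -> link x' y' -> ip x x' = 0 -> ip y y' = 0 ->
  is_defect (defect x x' y y') x x' y y'.
Proof.
move=> xy xy' xx yy; have [rx ry ixy _ _] := xy; have [rx' ry' ixy' _ _] := xy'.
apply: orth_defect => //; first exact: witt_orth.
  by apply: witt_l; rewrite // xx yy.
by apply: witt_r; rewrite // xx yy.
Qed.

Lemma real_mx_defect x x' y y' : link x y -> link x' y' -> ip x x' = ip y y' ->
  real_mx (defect x x' y y').
Proof.
move=> [rx ry _ _ _] [rx' ry' _ _ _] xy.
by apply: real_mxB; [apply: real_mxB|]; first exact: real_mx_witt;
  apply: real_mx_mul => //; apply: real_mx_tr.
Qed.

End Reflections.

(** * Biunitary matrices along a path *)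

Section Blocks.
Variables (C : numClosedFieldType) (n : nat).

Definition row_orth m (M : 'I_m -> 'I_m -> 'M[C]_n) :=
  forall p q, \sum_h M p h *m (M q h)^T = (p == q)%:R%:M.

(** For real blocks, [bflip] is the entrywise adjoint of [bmx M] and [btr] its transpose;
    biunitarity thus amounts to [row_orth] for the four matrices they generate from [M]. *)
Definition bflip m (M : 'I_m -> 'I_m -> 'M[C]_n) := fun p q => M q p.
Definition btr m (M : 'I_m -> 'I_m -> 'M[C]_n) := fun p q => (M p q)^T.

Variable m : nat.
Implicit Types M : 'I_m.+1 -> 'I_m.+1 -> 'M[C]_n.

Definition bmx M : 'M['M[C]_m.+1]_n := \matrix_(i, j) \matrix_(p, q) M p q i j.

Lemma star_bmx M : (forall p q, real_mx (M p q)) ->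
  forall i j, star (bmx M i j) = bmx (bflip M) i j.
Proof.
move=> rM i j; rewrite !mxE; apply/matrixP => p q.
rewrite /star /= /conjmx_tr !mxE; apply/CrealP; exact: rM.
Qed.

Lemma bmx_unitary M : (forall p q, real_mx (M p q)) ->
  row_orth M -> row_orth (btr (bflip M)) -> mx_unitary (bmx M).
Proof.
move=> rM H1 H2.
have mulE (A B : 'M[C]_m.+1) p q : (A * B) p q = \sum_h A p h * B h q.
  by rewrite -mulmxE mxE.
have idE p q i j : ((p == q)%:R%:M : 'M[C]_n) i j = (1%:M : 'M['M[C]_m.+1]_n) i j p q.
  rewrite !mxE; case: (i == j); last by rewrite !mulr0n mxE.
  by rewrite !mulr1n -idmxE mxE.
have starE i j : mxstar (bmx M) i j = bmx (bflip M) j i by rewrite -star_bmx // /mxstar mxE mxE.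
split; apply/matrixP => i j; apply/matrixP => p q.
  transitivity ((\sum_h M p h *m (M q h)^T) i j).
    rewrite mxE !summxE; under [RHS]eq_bigr do rewrite mxE.
    rewrite exchange_big /=; apply: eq_bigr => k _; rewrite starE mulE.
    by apply: eq_bigr => h _; rewrite !mxE.
  by rewrite H1.
transitivity ((\sum_h (M h p)^T *m M h q) i j).
  rewrite mxE !summxE; under [RHS]eq_bigr do rewrite mxE.
  rewrite exchange_big /=; apply: eq_bigr => k _; rewrite starE mulE.
  by apply: eq_bigr => h _; rewrite !mxE.
have := H2 p q; under eq_bigr do rewrite /btr /bflip trmxK; move=> ->.
exact: idE.
Qed.

End Blocks.

(** * Completion of a labelled graph by its reversed copy *)

Section Ladder.
Variables (C : numClosedFieldType) (n k : nat).
Implicit Types (P : 'I_k -> 'I_k -> 'M[C]_n) (N : 'I_k -> 'M[C]_n).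

(* The copy [inr] of the vertices carries the edges of [P] reversed, so that a
   vertex and its copy have the same sets of labels to be completed. *)
Definition ladder P N1 N2 (p q : 'I_(k + k)) : 'M[C]_n :=
  match split p, split q with
  | inl a, inl b => P a b
  | inl a, inr b => if a == b then N1 a else 0
  | inr a, inl b => if a == b then N2 a else 0
  | inr a, inr b => P b a
  end.

Lemma split_lshift (a : 'I_k) : split (lshift k a) = inl a.
Proof. exact: (unsplitK (inl a)). Qed.

Lemma split_rshift (a : 'I_k) : split (rshift k a) = inr a.
Proof. exact: (unsplitK (inr a)). Qed.

Lemma ladder_flip P N1 N2 : bflip (ladder P N1 N2) = ladder (bflip P) N2 N1.
Proof.
apply/funext => p; apply/funext => q; rewrite /bflip /ladder.
by case: (split p) => a; case: (split q) => b //; rewrite eq_sym; case: eqP => // ->.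
Qed.

Lemma ladder_tr P N1 N2 : btr (ladder P N1 N2) =
  ladder (btr P) (fun a => (N1 a)^T) (fun a => (N2 a)^T).
Proof.
apply/funext => p; apply/funext => q; rewrite /btr /ladder.
by case: (split p) => a; case: (split q) => b //; case: eqP => // _; rewrite trmx0.
Qed.

Lemma sum_ifl a (A : 'M[C]_n) (F : 'I_k -> 'M[C]_n) :
  \sum_h (if a == h then A else 0) *m F h = A *m F a.
Proof.
rewrite (bigD1 a) //= eqxx big1 ?addr0 // => h ha.
by rewrite eq_sym (negbTE ha) mul0mx.
Qed.

Lemma sum_ifr a (A : 'M[C]_n) (F : 'I_k -> 'M[C]_n) :
  \sum_h F h *m (if a == h then A else 0)^T = F a *m A^T.
Proof.
rewrite (bigD1 a) //= eqxx big1 ?addr0 // => h ha.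
by rewrite eq_sym (negbTE ha) trmx0 mulmx0.
Qed.

(** The first two hypotheses say that the rungs supply what the rows of [P] and of its reverse lack;
    the last two make the products mixing both copies vanish. *)
Lemma row_orth_ladder P N1 N2 :
    (forall a b, \sum_h P a h *m (P b h)^T =
       if a == b then 1%:M - N1 a *m (N1 a)^T else 0) ->
    (forall a b, \sum_h P h a *m (P h b)^T =
       if a == b then 1%:M - N2 a *m (N2 a)^T else 0) ->
    (forall a b, P a b *m (N2 b)^T = 0) -> (forall a b, N1 a *m (P a b)^T = 0) ->
  row_orth (ladder P N1 N2).
Proof.
move=> H1 H2 H3 H4 p q; rewrite big_split_ord /= -(splitK p) -(splitK q).
have H3' a b : N2 b *m (P a b)^T = 0 by rewrite -[LHS]trmxK trmx_mul trmxK H3 trmx0.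
have H4' a b : P a b *m (N1 a)^T = 0 by rewrite -[LHS]trmxK trmx_mul trmxK H4 trmx0.
rewrite /ladder; case: (split p) => a; case: (split q) => b;
  rewrite ?unsplitK /=;
  under eq_bigr do rewrite split_lshift;
  under [X in _ + X]eq_bigr do rewrite split_rshift.
- rewrite H1 sum_ifl (inj_eq (@lshift_inj _ _)).
  have [<-|ab] := eqVneq a b; first by rewrite subrK.
  by rewrite trmx0 mulmx0 addr0 raddf0.
- by rewrite sum_ifl sum_ifr H3 H4 addr0 eq_lrshift raddf0.
- by rewrite sum_ifl sum_ifr H3' H4' addr0 eq_rlshift raddf0.
- rewrite H2 sum_ifl (inj_eq (@rshift_inj _ _)).
  have [<-|ab] := eqVneq a b; first by rewrite addrC subrK.
  by rewrite trmx0 mulmx0 addr0 raddf0.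
Qed.

End Ladder.

Section PathModel.
Variables (C : numClosedFieldType) (n k : nat).
Local Notation cvec := ('cV[C]_n).
Implicit Types (fx fy gx gy : nat -> cvec) (N : 'I_k.+1 -> 'M[C]_n).

(* Edge [e] joins the vertices [e.-1] and [e]; it has label [fx e *m (fy e)^T]
   forwards and [gx e *m (gy e)^T] backwards. *)
Definition path_block fx fy gx gy (a b : 'I_k.+1) : 'M[C]_n :=
  (if val b == a.+1 then fx b *m (fy b)^T else 0) +
  (if val a == b.+1 then gx a *m (gy a)^T else 0).

(** Edges outside 1 to [k] have zero labels, so the end vertices need no separate treatment.
    [path_orth] makes the two labels leaving the vertex [e] orthogonal, and likewise the two
    entering it. *)
Record path_data fx fy gx gy : Prop := PathData {
  path_f : forall e, link (fx e) (fy e);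
  path_b : forall e, link (gx e) (gy e);
  path_out : forall e, (e == 0%N) || (k < e)%N ->
    [/\ fx e = 0, fy e = 0, gx e = 0 & gy e = 0];
  path_orth : forall e, [/\ ip (fx e.+1) (gx e) = 0, ip (fy e.+1) (gy e) = 0,
    ip (gx e.+1) (fx e) = 0 & ip (gy e.+1) (fy e) = 0]
}.

Lemma path_data_flip fx fy gx gy : path_data fx fy gx gy -> path_data gx gy fx fy.
Proof.
case=> H1 H2 H3 H4; split=> // e; first by move=> /H3[].
by case: (H4 e).
Qed.

Lemma path_data_tr fx fy gx gy : path_data fx fy gx gy -> path_data fy fx gy gx.
Proof.
case=> H1 H2 H3 H4; split=> e; [exact: link_sym|exact: link_sym|by move=> /H3[]|].
by case: (H4 e).
Qed.

Lemma path_block_flip fx fy gx gy :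
  bflip (path_block fx fy gx gy) = path_block gx gy fx fy.
Proof. by apply/funext => a; apply/funext => b; rewrite /bflip /path_block addrC. Qed.

Lemma path_block_tr fx fy gx gy :
  btr (path_block fx fy gx gy) = path_block fy fx gy gx.
Proof.
apply/funext => a; apply/funext => b; rewrite /btr /path_block linearD /=.
by congr (_ + _); case: eqP => _; rewrite ?trmx0 // trmx_mul trmxK.
Qed.

Definition is_path_defect N fx fy gx gy :=
  forall a : 'I_k.+1, is_defect (N a) (fx a.+1) (gx a) (fy a.+1) (gy a).

Lemma link_mulT (x y : cvec) : link x y -> x *m y^T *m (x *m y^T)^T = x *m x^T.
Proof.
move=> [_ _ xy xl yl].
rewrite trmx_mul trmxK -mulmxA (mulmxA y^T) ipE mulmxA mul_mx_scalar -xy.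
by rewrite xl.
Qed.

Lemma ip0_mulT (x y x' y' : cvec) : ip y y' = 0 -> x *m y^T *m (x' *m y'^T)^T = 0.
Proof.
move=> yy; rewrite trmx_mul trmxK -mulmxA (mulmxA y^T) ipE yy.
by rewrite raddf0 mul0mx mulmx0.
Qed.

(** Distinct rows can only meet at a common neighbour, where [path_orth] kills the product; a row
    with itself gives the projections on the labels leaving [a], complementary to
    [N a *m (N a)^T]. *)
Lemma path_block_mulT fx fy gx gy N : path_data fx fy gx gy ->
    is_path_defect N fx fy gx gy ->
  forall a b, \sum_h path_block fx fy gx gy a h *m (path_block fx fy gx gy b h)^T =
    if a == b then 1%:M - N a *m (N a)^T else 0.
Proof.
move=> [Hf Hb Hout Horth] HN a b.
pose F e := fx e *m (fy e)^T; pose B e := gx e *m (gy e)^T.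
have pick c (f : nat -> 'M[C]_n) :
    \sum_(h < k.+1) (if val h == c then f h else 0) = if (c < k.+1)%N then f c else 0.
  case: ltnP => ck; last first.
    by rewrite big1 // => h _; case: eqP => // hc; move: ck; rewrite -hc leqNgt ltn_ord.
  rewrite (bigD1 (Ordinal ck)) //= eqxx big1 ?addr0 // => h hc.
  by case: eqP => // e; case/eqP: hc; apply: val_inj.
(* The neighbours of [a] are [a.+1] and [a.-1]; the guard [0 < a] discards the spurious
   [0.-1 = 0]. *)
transitivity (\sum_(h < k.+1) (if val h == a.+1 then
    (if a == b then F a.+1 *m (F a.+1)^T else 0) else 0) +
  \sum_(h < k.+1) (if val h == a.-1 then
    (if (a == b) && (0 < a)%N then B a *m (B a)^T else 0) else 0)).
  rewrite -big_split; apply: eq_bigr => h _; rewrite /path_block -/(F h) -/(B a) -/(B b).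
  rewrite linearD /= mulmxDl !mulmxDr addrA; congr (_ + _); last first.
    have [<-|ab] := eqVneq a b.
      case: eqP => [ah|ah]; last first.
        by rewrite mul0mx; case: eqP => //; case: ltnP => //; lia.
      by rewrite ah eqxx.
    case: eqP => [ah|ah]; last by rewrite mul0mx if_same.
    case: eqP => [bh|bh]; last by rewrite trmx0 mulmx0 if_same.
    by case/eqP: ab; apply: val_inj; rewrite /= ah bh.
  have -> : (if val h == a.+1 then F h else 0) *m (if val b == h.+1 then B b else 0)^T = 0.
    case: eqP => ha; last by rewrite mul0mx.
    case: eqP => [bh|_]; last by rewrite trmx0 mulmx0.
    by apply: ip0_mulT; rewrite bh ipC; case: (Horth h).
  have -> : (if val a == h.+1 then B a else 0) *m (if val h == b.+1 then F h else 0)^T = 0.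
    case: eqP => [ah|_]; last by rewrite mul0mx.
    case: eqP => hb; last by rewrite trmx0 mulmx0.
    by apply: ip0_mulT; rewrite ah; case: (Horth h).
  rewrite !addr0; case: eqP => [ha|_]; last by rewrite mul0mx.
  have [<-|ab] := eqVneq a b; first by rewrite ha eqxx.
  case: eqP => [hb|_]; last by rewrite trmx0 mulmx0.
  by case/eqP: ab; apply: val_inj; apply: succn_inj; rewrite /= -ha -hb.
rewrite (pick a.+1 (fun=> _)) (pick a.-1 (fun=> _)) (leq_ltn_trans (leq_pred _) (ltn_ord a)).
have [_|_] /= := eqVneq a b; last by rewrite if_same addr0.
have subK2 (X Y Z : 'M[C]_n) : X - (X - Y - Z) = Y + Z by rewrite -[X - Y - Z]addrA -opprD subKr.
rewrite (defect_mulT (HN a)) subK2.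
rewrite /F /B !link_mulT //; congr (_ + _).
  case: ltnP => // ka; have [-> _ _ _] := Hout a.+1 ka.
  by rewrite mul0mx.
case: posnP => // ->; have [_ _ -> _] := Hout 0%N isT.
by rewrite mul0mx.
Qed.

Lemma row_orth_path fx fy gx gy N1 N2 : path_data fx fy gx gy ->
    is_path_defect N1 fx fy gx gy -> is_path_defect N2 gx gy fx fy ->
  row_orth (ladder (path_block fx fy gx gy) N1 N2).
Proof.
move=> D H1 H2; apply: row_orth_ladder.
- exact: path_block_mulT D H1.
- move=> a b; rewrite -(path_block_mulT (path_data_flip D) H2) -path_block_flip.
  by [].
- move=> a b; rewrite /path_block mulmxDl -[RHS](addr0 0); congr (_ + _).
    case: eqP => _; last by rewrite mul0mx.
    by rewrite -mulmxA -trmx_mul (defect_r (H2 b)) trmx0 mulmx0.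
  case: eqP => [->|_]; last by rewrite mul0mx.
  by rewrite -mulmxA -trmx_mul (defect_l (H2 b)) trmx0 mulmx0.
- move=> a b; rewrite /path_block linearD /= mulmxDr -[RHS](addr0 0); congr (_ + _).
    case: eqP => [->|_]; last by rewrite trmx0 mulmx0.
    by rewrite trmx_mul trmxK mulmxA (defect_l (H1 a)) mul0mx.
  case: eqP => _; last by rewrite trmx0 mulmx0.
  by rewrite trmx_mul trmxK mulmxA (defect_r (H1 a)) mul0mx.
Qed.

Variables (fx fy gx gy : nat -> cvec).
Hypothesis D : path_data fx fy gx gy.

Let N1 (a : 'I_k.+1) := defect (fx a.+1) (gx a) (fy a.+1) (gy a).
Let N2 (a : 'I_k.+1) := defect (gx a.+1) (fx a) (gy a.+1) (fy a).

(** The index type is ['I_(k.+1 + k.+1)] up to conversion, in the successor form needed for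
    ['M_m.+1]. *)
Definition path_model : 'I_(k + k.+1).+1 -> 'I_(k + k.+1).+1 -> 'M[C]_n :=
  ladder (path_block fx fy gx gy) N1 N2.

Let N1P : is_path_defect N1 fx fy gx gy.
Proof.
by case: D => Hf Hb _ Ho a; apply: defectP => //; case: (Ho a).
Qed.

Let N2P : is_path_defect N2 gx gy fx fy.
Proof.
by case: D => Hf Hb _ Ho a; apply: defectP => //; case: (Ho a).
Qed.

Let is_path_defect_tr N fx' fy' gx' gy' : is_path_defect N fx' fy' gx' gy' ->
  is_path_defect (fun a => (N a)^T) fy' fx' gy' gx'.
Proof. by move=> H a; apply: is_defect_tr. Qed.

Lemma real_path_model p q : real_mx (path_model p q).
Proof.
have r0 : real_mx (0 : 'M[C]_n) by move=> i j; rewrite mxE real0.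
have rxy x y : link x y -> real_mx (x *m y^T).
  by case=> rx ry _ _ _; apply: real_mx_mul => //; apply: real_mx_tr.
case: D => Hf Hb _ Ho.
have rP a b : real_mx (path_block fx fy gx gy a b).
  by move=> i j; rewrite mxE; apply: realD; case: eqP => _; try exact: r0; apply: rxy.
rewrite /path_model /ladder.
case: (@split k.+1 k.+1 p) => a; case: (@split k.+1 k.+1 q) => b //; case: eqP => // _;
  by apply: real_mx_defect => //; case: (Ho a) => h1 h2 h3 h4; rewrite ?h1 ?h3.
Qed.

Lemma path_model_unitary : mx_unitary (bmx path_model) /\ mx_unitary (bmx path_model)^T.
Proof.
have H : row_orth path_model by exact: row_orth_path D N1P N2P.
have Hf : row_orth (bflip path_model).
  rewrite /path_model (ladder_flip (path_block fx fy gx gy) N1 N2) path_block_flip.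
  exact: row_orth_path (path_data_flip D) N2P N1P.
have Ht : row_orth (btr path_model).
  rewrite /path_model (ladder_tr (path_block fx fy gx gy) N1 N2) path_block_tr.
  exact: row_orth_path (path_data_tr D) (is_path_defect_tr N1P) (is_path_defect_tr N2P).
have Hft : row_orth (btr (bflip path_model)).
  rewrite /path_model (ladder_flip (path_block fx fy gx gy) N1 N2) path_block_flip.
  rewrite (ladder_tr (path_block gx gy fx fy) N2 N1) path_block_tr.
  apply: row_orth_path (path_data_tr (path_data_flip D)) _ _; exact: is_path_defect_tr.
split; first exact: bmx_unitary real_path_model H Hft.
have -> : (bmx path_model)^T = bmx (btr path_model).
  by apply/matrixP => i j; rewrite !mxE; apply/matrixP => p q; rewrite !mxE.
apply: bmx_unitary => //; first by move=> p q; apply/real_mx_tr/real_path_model.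
suff -> : btr (bflip (btr path_model)) = bflip path_model by [].
by apply/funext => p; apply/funext => q; rewrite /btr /bflip trmxK.
Qed.

End PathModel.

(** * Matrix entries of words along the path *)

Section PathWords.
Variables (C : numClosedFieldType) (n k : nat) (G : finType) (conjugated : G -> bool).
Variables (fx fy gx gy : nat -> 'cV[C]_n).

Let M := @path_model C n k fx fy gx gy.
Definition path_gen (c : G) (i j : 'I_n) : 'M[C]_((k + k.+1).+1) :=
  bmx (if conjugated c then bflip M else M) i j.

Let l (a : 'I_k.+1) : 'I_(k + k.+1).+1 := lshift k.+1 a.
Let r (a : 'I_k.+1) : 'I_(k + k.+1).+1 := rshift k.+1 a.

Lemma path_gen_step c i j (a b : 'I_k.+1) : val b = a.+1 ->
  path_gen c i j (l a) (l b) =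
  (if conjugated c then gx b else fx b) i 0 * (if conjugated c then gy b else fy b) j 0.
Proof.
move=> ab; have ba : (val a == b.+1) = false by move: ab => /= ->; apply/eqP; lia.
rewrite /path_gen !mxE; case: (conjugated c); rewrite /bflip /M /path_model /ladder;
  rewrite !(split_lshift a) !(split_lshift b) /path_block ba ab eqxx.
  by rewrite add0r mxE big_ord1 !mxE.
by rewrite addr0 mxE big_ord1 !mxE.
Qed.

Lemma path_gen_far c i j (a b : 'I_k.+1) : val b != a.+1 -> val a != b.+1 ->
  path_gen c i j (l a) (l b) = 0 /\ path_gen c i j (r a) (r b) = 0.
Proof.
move=> /negbTE ab /negbTE ba.
rewrite /path_gen !mxE; case: (conjugated c); rewrite /bflip /M /path_model /ladder;
  rewrite !(split_lshift a) !(split_lshift b) !(split_rshift a) !(split_rshift b);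
  by rewrite /path_block ba ab addr0 mxE.
Qed.

Lemma path_gen_cross c i j (a b : 'I_k.+1) : a != b ->
  path_gen c i j (l a) (r b) = 0 /\ path_gen c i j (r a) (l b) = 0.
Proof.
move=> ab; have ba : b != a by rewrite eq_sym.
rewrite /path_gen !mxE; case: (conjugated c); rewrite /bflip /M /path_model /ladder;
  rewrite !(split_lshift a) !(split_lshift b) !(split_rshift a) !(split_rshift b);
  by rewrite ?(negbTE ab) ?(negbTE ba) mxE.
Qed.

Fixpoint edge_weight (e : nat) (w : seq (G * ('I_n * 'I_n))) : C :=
  if w is t :: w' then
    (if conjugated t.1 then gx e.+1 else fx e.+1) t.2.1 0 *
    (if conjugated t.1 then gy e.+1 else fy e.+1) t.2.2 0 * edge_weight e.+1 w'
  else 1.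

(** A letter advances by at most one vertex, and crossing to the other copy does not advance. With
    at most [k - a] letters, only [k - a] forward steps in the first copy lead to its end, and
    nothing does from the second copy. *)
Lemma path_gen_mono w (a : 'I_k.+1) : (size w + a <= k)%N ->
  mono path_gen w (l a) (l ord_max) = (if size w + a == k then edge_weight a w else 0)
  /\ mono path_gen w (r a) (l ord_max) = 0.
Proof.
elim: w a => [|t w IHw] a /=.
  move=> _; rewrite ?add0n /mono big_nil -idmxE !mxE; split.
    by rewrite -val_eqE /=; case: eqP.
  by rewrite -val_eqE /=; case: eqP => //; have := ltn_ord a; lia.
move=> Hw; have ak : (a.+1 < k.+1)%N by lia.
have Ew : mono path_gen (t :: w) = path_gen t.1 t.2.1 t.2.2 *m mono path_gen w.
  by rewrite /mono big_cons.
have IHl (h : 'I_k.+1) : (h <= a)%N -> mono path_gen w (l h) (l ord_max) = 0.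
  by move=> ha; have [|-> _] := IHw h; [lia|case: eqP => //; lia].
have IHr (h : 'I_k.+1) : (h <= a.+1)%N -> mono path_gen w (r h) (l ord_max) = 0.
  by move=> ha; have [|_ ->] := IHw h; [lia|].
rewrite Ew !mxE; split.
  rewrite [LHS](@big_split_ord _ _ _ k.+1 k.+1) /=.
  rewrite [X in _ + X]big1 ?addr0 => [|h _]; last first.
    have [<-|ah] := eqVneq a h; first by rewrite (IHr a) ?mulr0.
    by have [E _] := path_gen_cross t.1 t.2.1 t.2.2 ah; rewrite [X in X * _]E mul0r.
  rewrite (bigD1 (Ordinal ak)) //= big1 ?addr0 => [|h hn].
    rewrite [X in X * _](path_gen_step t.1 t.2.1 t.2.2 (b := Ordinal ak)) //.
    have [|E _] := IHw (Ordinal ak); first by rewrite /=; lia.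
    rewrite [X in _ * X]E [X in X == _](_ : _ = ((size w).+1 + a)%N); last first.
      by rewrite /=; lia.
    by case: eqP => // _; exact: mulr0.
  have [ha|ha] := leqP h a; first by rewrite [X in _ * X]IHl ?mulr0.
  have [||E _] := @path_gen_far t.1 t.2.1 t.2.2 a h.
  - by apply: contra hn => /eqP hE; apply/eqP/val_inj.
  - by rewrite /=; lia.
  - by rewrite [X in X * _]E mul0r.
rewrite [LHS](@big_split_ord _ _ _ k.+1 k.+1) /=.
rewrite big1 ?add0r => [|h _]; last first.
  have [<-|ah] := eqVneq a h; first by rewrite [X in _ * X]IHl ?mulr0.
  by have [_ E] := path_gen_cross t.1 t.2.1 t.2.2 ah; rewrite [X in X * _]E mul0r.
apply: big1 => h _.
have [ha|ha] := leqP h a.+1; first by rewrite [X in _ * X]IHr ?mulr0.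
have [||_ E] := @path_gen_far t.1 t.2.1 t.2.2 a h.
- by rewrite /=; lia.
- by rewrite /=; lia.
- by rewrite [X in X * _]E mul0r.
Qed.

End PathWords.

(** * The quantum groups *)

Section ChainModel.
Variables (C : numClosedFieldType) (n : nat) (G : finType) (adj : rel G) (c0 : G).
(** [forward] and [backward] tell in which directions an edge of a given colour carries its label.
    Conjugated generators read backward labels, so [dirE] says that a generator sees exactly the
    edges of its own colour. *)
Variables (conjugated forward backward : G -> bool).
Hypothesis dirE : forall c c',
  (if conjugated c then backward c' else forward c') = (c == c').
Hypothesis adjE : forall c c',
  (forward c' && backward c) || (backward c' && forward c) -> adj c c'.
Local Notation vec := ('I_n -> C).

Definition colv (x : vec) : 'cV[C]_n := \col_i x i.

Lemma ip_colv x y : ip (colv x) (colv y) = dot x y.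
Proof. by rewrite /ip mxE; apply: eq_bigr => i _; rewrite !mxE. Qed.

Lemma link_colv (x y : vec) : realv x -> realv y -> dot x x = 1 -> dot y y = 1 ->
  link (colv x) (colv y).
Proof.
move=> rx ry xx yy; split; rewrite ?ip_colv ?xx ?yy ?scale1r //.
  by move=> i j; rewrite mxE.
by move=> i j; rewrite mxE.
Qed.

Lemma link0 : link (0 : 'cV[C]_n) 0.
Proof. by split; rewrite ?scaler0 // => i j; rewrite mxE real0. Qed.

Lemma chain_nth s (xs : seq vec) e : chain adj s xs -> (e < size s)%N ->
  [/\ realv (nth (fun=> 0) xs e), dot (nth (fun=> 0) xs e) (nth (fun=> 0) xs e) = 1 &
      (e.+1 < size s)%N -> adj (nth c0 s e) (nth c0 s e.+1) ->
      dot (nth (fun=> 0) xs e) (nth (fun=> 0) xs e.+1) = 0].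
Proof.
elim: s xs e => [|c s IHs] [|x xs] [|e] //= [rx xx cx sx] es; last exact: IHs.
split=> // es1 cc; have /= := cx; case: s {IHs es cx} es1 cc sx => // c' s _ /= cc.
by case: xs => // y ys _ /(_ cc).
Qed.

Variables (s : seq G) (xs ys : seq vec).
Hypotheses (chx : chain adj s xs) (chy : chain adj s ys).

(** Edge [e] carries the entry [e.-1] of the chain, index 0 being the absent edge before the first
    vertex. *)
Definition edge (open : G -> bool) (zs : seq vec) (e : nat) : 'cV[C]_n :=
  if e is e'.+1 then
    if (e' < size s)%N && open (nth c0 s e') then colv (nth (fun=> 0) zs e') else 0
  else 0.

Lemma edge_link open e : link (edge open xs e) (edge open ys e).
Proof.
case: e => [|e] /=; first exact: link0.
case: ifP => [/andP[es _]|_]; last exact: link0.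
have [rx xx _] := chain_nth chx es; have [ry yy _] := chain_nth chy es.
exact: link_colv.
Qed.

Lemma edge_orth open1 open2 zs e : chain adj s zs ->
  (forall c c', open1 c' && open2 c -> adj c c') ->
  ip (edge open1 zs e.+1) (edge open2 zs e) = 0.
Proof.
move=> chz o12; case: e => [|e] /=; first by rewrite /ip mulmx0 mxE.
case: ifP => [/andP[es o1]|_]; last by rewrite /ip trmx0 mul0mx mxE.
case: ifP => [/andP[es1 o2]|_]; last by rewrite /ip mulmx0 mxE.
rewrite ip_colv dotC; have [_ _ H] := chain_nth chz es1; apply: H => //.
by apply: o12; rewrite o1 o2.
Qed.

Lemma edge_path_data :
  path_data (size s) (edge forward xs) (edge forward ys)
    (edge backward xs) (edge backward ys).
Proof.
split=> e; try exact: edge_link.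
  by case: e => [|e] //=; rewrite ltnS => es; rewrite ltnNge es.
split; apply: edge_orth => // c c' H; apply: adjE; rewrite H //; exact: orbT.
Qed.

Lemma edge_weight_path w e : (size w + e = size s)%N ->
  edge_weight conjugated (edge forward xs) (edge forward ys) (edge backward xs)
    (edge backward ys) e w =
  path_weight (drop e s) (drop e xs) (drop e ys) w.
Proof.
have sx := size_chain chx; have sy := size_chain chy.
elim: w e => [|t w IHw] e /= Hw.
  by rewrite !drop_oversize // ?sx ?sy -Hw.
have es : (e < size s)%N by rewrite -Hw; lia.
rewrite (drop_nth c0) // (drop_nth (fun=> 0) (s := xs)) ?sx //.
rewrite (drop_nth (fun=> 0) (s := ys)) ?sy //= -IHw; last by rewrite -Hw; lia.
congr (_ * _); rewrite es /=.
have := dirE t.1 (nth c0 s e); case: (conjugated _) => <-; case: (_ (nth c0 s e));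
  by rewrite /= !mxE ?mul1r ?mul0r.
Qed.

Lemma chain_model : exists m (U : 'M['M[C]_m.+1]_n) p q,
  [/\ mx_unitary U, mx_unitary U^T,
      forward =1 backward -> forall i j, star (U i j) = U i j,
      forall w, (size w < size s)%N -> mono
        (fun c i j => if conjugated c then star (U i j) else U i j) w p q = 0 &
      forall w, size w = size s -> mono
        (fun c i j => if conjugated c then star (U i j) else U i j) w p q =
        path_weight s xs ys w].
Proof.
set k := size s; have D := edge_path_data.
set M := @path_model C n k (edge forward xs) (edge forward ys)
   (edge backward xs) (edge backward ys).
have rM : forall p q, real_mx (M p q) := real_path_model D.
have [U1 U2] := path_model_unitary D.
have monoE w : mono (fun c i j => if conjugated c then star (bmx M i j) else bmx M i j) w =
    mono (path_gen k conjugated (edge forward xs) (edge forward ys)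
      (edge backward xs) (edge backward ys)) w.
  rewrite /mono; apply: eq_bigr => t _; rewrite /path_gen.
  by case: (conjugated _); rewrite // star_bmx.
have H w : (size w <= k)%N -> mono (path_gen k conjugated (edge forward xs)
    (edge forward ys) (edge backward xs) (edge backward ys)) w
    (lshift k.+1 (ord0 : 'I_k.+1)) (lshift k.+1 (ord_max : 'I_k.+1)) =
    if size w == k then path_weight s xs ys w else 0.
  move=> sw; have [|E _] := @path_gen_mono C n k G conjugated (edge forward xs)
    (edge forward ys) (edge backward xs) (edge backward ys) w ord0.
    by rewrite [(_ + _)%N]addn0.
  rewrite [LHS]E [X in X == _](_ : _ = size w); last exact: addn0.
  case: eqP => // sw0.
  by rewrite edge_weight_path ?addn0 // !drop0.
exists _, (bmx M), (lshift k.+1 (ord0 : 'I_k.+1)), (lshift k.+1 (ord_max : 'I_k.+1)).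
split=> // [fb i j|w sw|w sw]; last 2 first.
- by rewrite monoE H ?(ltnW sw) // ltn_eqF.
- by rewrite monoE H ?sw // eqxx.
(* Equal labels in both directions make the model invariant under [bflip]. *)
rewrite star_bmx //; congr (bmx _ i j).
have E : forward = backward by apply/funext.
rewrite /M E /path_model.
rewrite (ladder_flip (path_block _ _ _ _) _ _) path_block_flip.
by [].
Qed.

End ChainModel.

(** * Images of free words in the generators *)

Section Generators.
Variables (C : numClosedFieldType) (B : starAlgType C) (n : nat).

Lemma mx_unitaryE (U : 'M[B]_n) : mx_unitary U ->
  (forall a b, \sum_j U a j * star (U b j) = (a == b)%:R) /\
  (forall a b, \sum_j star (U j a) * U j b = (a == b)%:R).
Proof.
move=> [/matrixP H1 /matrixP H2]; split=> a b.
  have := H1 a b; rewrite mxE [RHS]mxE => <-.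
  by apply: eq_bigr => j _; rewrite !mxE.
have := H2 a b; rewrite mxE [RHS]mxE => <-.
by apply: eq_bigr => j _; rewrite !mxE.
Qed.

Variable X : choiceType.
Local Notation F := (free_star C X).
Variable f : {lrmorphism F -> B}.
Hypothesis fS : {morph f : x / star x}.

Lemma free_word (s : seq (bool * X)) : f << FMonom s >> =
  \prod_(l <- s) (if l.1 then star (f (free_gen l.2)) else f (free_gen l.2)).
Proof.
elim: s => [|[b x] s IHs].
  rewrite big_nil -[RHS](rmorph1 f); congr (f _).
  apply/malgP => w; rewrite mcoeffU [RHS]mcoeff1; congr (_ *+ _).
  by rewrite eq_sym; congr (nat_of_bool (_ == _)); apply/eqP; rewrite fmP fm1.
have -> : << FMonom ((b, x) :: s) >> = << fmu (b, x) >> * << FMonom s >> :> F.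
  have -> : FMonom ((b, x) :: s) = mmul (fmu (b, x)) (FMonom s).
    by apply/eqP; rewrite fmP fmM fmU.
  by rewrite [RHS]fgmulUU mulr1.
rewrite rmorphM /= IHs big_cons; congr (_ * _); case: b => //=.
rewrite -fS; congr (f _); rewrite [RHS]free_starU conjC1.
have -> : word_star (fmu (false, x)) = fmu (true, x) by apply/eqP; rewrite fmP /= !fmU.
by [].
Qed.

Variables (G : finType) (v : G -> 'I_n -> 'I_n -> B).
Variable letter : bool * X -> G * ('I_n * 'I_n).
Hypothesis v_letter : forall l, v (letter l).1 (letter l).2.1 (letter l).2.2 =
  if l.1 then star (f (free_gen l.2)) else f (free_gen l.2).

Lemma free_deg_lt g : exists k, deg_lt v k (f g).
Proof.
rewrite (monalgE g) raddf_sum; apply: (big_ind (fun a => exists k, deg_lt v k a)).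
- by exists 0%N.
- move=> a b [k Ha] [k' Hb]; exists (maxn k k'); apply: deg_ltD.
    by apply: deg_lt_le Ha; apply: leq_maxl.
  by apply: deg_lt_le Hb; apply: leq_maxr.
move=> [s] _; exists (size s).+1.
have -> : << g@_(FMonom s) *g FMonom s >> = g@_(FMonom s) *: (<< FMonom s >> : F).
  by apply/malgP => w; rewrite [RHS]mcoeffZ !mcoeffU mulr_natr.
apply: (eq_ind_r (deg_lt v _)); last exact: (linearZ_LR f (g@_(FMonom s)) (<< FMonom s >> : F)).
apply: deg_ltZ; apply: (eq_ind_r (deg_lt v _)); last exact: (free_word s).
have -> : \prod_(l <- s) (if l.1 then star (f (free_gen l.2)) else f (free_gen l.2)) =
    mono v (map letter s).
  by rewrite /mono big_map; apply: eq_bigr => l _; rewrite v_letter.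
by apply: deg_lt_mono; rewrite size_map.
Qed.

End Generators.

(** * The criterion for universal biunitaries *)

Section Criteria.
Variables (C : numClosedFieldType) (n : nat) (B : starAlgType C) (U : 'M[B]_n).
Hypotheses (n_gt1 : (1 < n)%N) (U1 : mx_unitary U) (U2 : mx_unitary U^T).

Definition star_gen (c : bool) (i j : 'I_n) : B := if c then star (U i j) else U i j.

Lemma RFD_of_universal :
    (forall a, exists k, deg_lt star_gen k a) ->
    (forall m (V : 'M['M[C]_m.+1]_n), mx_unitary V -> mx_unitary V^T ->
      exists pi : {lrmorphism B -> 'M[C]_m.+1},
        {morph pi : a / star a} /\ map_mx pi U = V) ->
  RFD B.
Proof.
move=> gen univ.
have [[V1 V2] [V3 V4]] := (mx_unitaryE U1, mx_unitaryE U2).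
apply: (@RFD_of_path C n _ (fun c c' => c != c') B star_gen n_gt1) => //.
- move=> [] [] //= _ a b.
  by rewrite -V3; apply: eq_bigr => j _; rewrite !mxE.
- move=> [] [] //= _ a b.
  by rewrite -V4; apply: eq_bigr => j _; rewrite !mxE.
move=> s xs ys cx cy.
(* The colour [true] marks adjoints; its edges carry labels backwards only, those of colour [false]
   forwards only. *)
have [||m [V [p [q [V1' V2' _ Hlt Heq]]]]] :=
  @chain_model C n bool (fun c c' => c != c') false id negb id _ _ s xs ys cx cy.
- by case=> [] [].
- by case=> [] [].
have [pi [piS piE]] := univ m V V1' V2'.
exists m, pi, p, q.
have piv w : pi (mono star_gen w) =
    mono (fun c i j => if id c then star (V i j) else V i j) w.
  rewrite rmorph_prod; apply: eq_bigr => -[c [i j]] _ /=.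
  by rewrite /star_gen -piE mxE; case: c => //; rewrite piS.
by split=> // w sw; rewrite piv; [apply: Hlt | apply: Heq].
Qed.

Lemma RFD_of_real_universal : (forall i j, star (U i j) = U i j) ->
    (forall a, exists k, deg_lt (fun _ : unit => U) k a) ->
    (forall m (V : 'M['M[C]_m.+1]_n), mx_unitary V -> mx_unitary V^T ->
      (forall i j, star (V i j) = V i j) ->
      exists pi : {lrmorphism B -> 'M[C]_m.+1},
        {morph pi : a / star a} /\ map_mx pi U = V) ->
  RFD B.
Proof.
move=> US gen univ.
have [[V1 V2] _] := (mx_unitaryE U1, mx_unitaryE U2).
apply: (@RFD_of_path C n _ (fun _ _ => true) B (fun _ => U) n_gt1) => //.
- by move=> _ _ _ a b; rewrite -V2; apply: eq_bigr => j _; rewrite US.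
- by move=> _ _ _ a b; rewrite -V1; apply: eq_bigr => j _; rewrite US.
move=> s xs ys cx cy.
(* The single colour is contractible with itself, and each edge carries its label both ways, which
   makes [V] self-adjoint entrywise. *)
have [||m [V [p [q [V1' V2' VS Hlt Heq]]]]] :=
  @chain_model C n unit (fun _ _ => true) tt (fun=> false) (fun=> true) (fun=> true)
    _ _ s xs ys cx cy.
- by case=> [] [].
- by [].
have [pi [piS piE]] := univ m V V1' V2' (VS (fun=> erefl)).
exists m, pi, p, q.
have piv w : pi (mono (fun _ : unit => U) w) = mono (fun _ i j => V i j) w.
  by rewrite rmorph_prod; apply: eq_bigr => -[c [i j]] _ /=; rewrite -piE mxE.
by split=> // w sw; rewrite piv; [apply: Hlt | apply: Heq].
Qed.

End Criteria.

Section QuantumGroups.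
Variables (C : numClosedFieldType) (n : nat).
Hypothesis n_gt1 : (1 < n)%N.

Lemma A_u_gen a : exists k, deg_lt (star_gen (A_u_mx C n)) k a.
Proof.
have [g <-] := star_quot_piP a.
apply: (@free_deg_lt C (A_u C n) n _ (star_quot_pi (@A_u_proper C n)) _ _ _ id).
  exact: star_quot_pi_star.
by case=> c [i j]; rewrite /star_gen /A_u_mx /free_mx !mxE.
Qed.

Lemma B_u_gen a : exists k, deg_lt (fun _ : unit => B_u_mx C n) k a.
Proof.
have [g <-] := star_quot_piP a.
(* A letter and its adjoint have the same image, so the boolean is forgotten. *)
apply: (@free_deg_lt C (B_u C n) n _ (star_quot_pi (@B_u_proper C n)) _ _ _
  (fun l => (tt, l.2))).
  exact: star_quot_pi_star.
have E i j : B_u_mx C n i j = star_quot_pi (@B_u_proper C n) (free_gen (i, j)).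
  by rewrite /B_u_mx /free_mx !mxE.
by case=> c [i j] /=; rewrite -E B_u_mx_selfadj; case: c.
Qed.

Lemma RFD_A_u : RFD (A_u C n).
Proof.
have [U1 U2] := A_u_mx_unitary C n.
apply: (RFD_of_universal n_gt1 U1 U2); first exact: A_u_gen.
by move=> m V V1 V2; apply: A_u_universal.
Qed.

Lemma RFD_B_u : RFD (B_u C n).
Proof.
have [U1 U2] := B_u_mx_unitary C n.
apply: (RFD_of_real_universal n_gt1 U1 U2); [exact: B_u_mx_selfadj|exact: B_u_gen|].
by move=> m V V1 V2 VS; apply: B_u_universal.
Qed.

End QuantumGroups.

Theorem theorem3p1 (R : realType) (n : nat) (n_ge2 : (2 <= n)%N)
    (n_neq3 : n <> 3%N) :
  RFD (A_u R[i] n) /\ RFD (B_u R[i] n).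
Proof. by split; [exact: RFD_A_u | exact: RFD_B_u]. Qed.
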